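(* Let $n,p$ be positive integers with $n-p-1>0$ and $p \geq 2$. Observe $Y \in \mathbb{R}^{n\times p}$ whose entries are independent with $Y_{ai} \sim \mathrm{N}(M_{ai},1)$, where $M \in \mathbb{R}^{n \times p}$ is unknown, and estimate $M$ under the Frobenius loss $\|\hat M - M\|_{\mathrm F}^2=\sum_{a,i}(\hat M_{ai}-M_{ai})^2$. Let $\pi_{\mathrm{SVS}}(M)=\det(M^\top M)^{-(n-p-1)/2}$. Then the generalized Bayes estimator of $M$ with respect to $\pi_{\mathrm{SVS}}$ is inadmissible under the Frobenius loss, i.e., there exists an estimator $\tilde M(Y)$ with $\mathrm{E}_M\|\tilde M-M\|_{\mathrm F}^2 \le \mathrm{E}_M\|\hat M_{\mathrm{SVS}}-M\|_{\mathrm F}^2$ for all $M$, with strict inequality for some $M$.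
   Context: For a nonnegative function $\pi$ on $\mathbb{R}^{n\times p}$ (an improper prior) whose marginal $m_\pi(Y)=\int p(Y\mid M)\pi(M)\,\mathrm{d}M$ is finite for every $Y$ (where $p(Y\mid M)$ is the density of $Y$), the generalized Bayes estimator is the posterior mean $\hat M_\pi(Y)=\int M\, p(Y\mid M)\pi(M)\,\mathrm dM / m_\pi(Y)$. For $\pi_{\mathrm{SVS}}$ the marginal is finite for every $Y$; $\hat M_{\mathrm{SVS}}$ denotes its generalized Bayes estimator. *)

(* Defs.v *)
From HB Require Import structures.
From mathcomp Require Import all_boot all_order all_algebra.
From mathcomp Require Import all_classical all_reals all_analysis.
Set Implicit Arguments. Unset Strict Implicit. Unset Printing Implicit Defensive.
Import Order.TTheory GRing.Theory Num.Theory.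
Local Open Scope classical_set_scope.
Local Open Scope ring_scope.

Section Defs.
Context {R : realType}.

(* k-dimensional Lebesgue measure on k.-tuple R (k.-tuple R carries the
   product (coordinate) sigma-algebra from the library), built as the
   iterated product  lambda (x) lambda (x) ... (x) lambda  via sections:
   leb_tuple (k+1) A = int_R leb_tuple k {t | x :: t in A} dx. *)
Fixpoint leb_tuple (k : nat) : set (k.-tuple R) -> \bar R :=
  match k with
  | 0 => fun A => (\1_A [tuple] : R)%:E
  | k'.+1 => fun A =>
      (\int[@lebesgue_measure R]_x @leb_tuple k' [set t | A (cons_tuple x t)])%E
  end.
Arguments leb_tuple : clear implicits.

Definition tmx (n p : nat) (t : (n * p).-tuple R) : 'M[R]_(n, p) :=
  vec_mx (\row_i tnth t i).

Definition frob2 (n p : nat) (A : 'M[R]_(n, p)) : R :=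
  \sum_(a < n) \sum_(i < p) A a i ^+ 2.

Definition gdens (n p : nat) (Y M : 'M[R]_(n, p)) : R :=
  (2 * pi) `^ (- ((n * p)%:R / 2)) * expR (- (frob2 (Y - M) / 2)).

Definition pi_svs (n p : nat) (M : 'M[R]_(n, p)) : R :=
  (\det (M^T *m M)) `^ (- ((n%:R - p%:R - 1) / 2)).

Definition marginal (n p : nat) (prior : 'M[R]_(n, p) -> R) (Y : 'M[R]_(n, p))
  : \bar R :=
  (\int[leb_tuple (n * p)]_t (gdens Y (tmx t) * prior (tmx t))%:E)%E.

Definition gen_bayes (n p : nat) (prior : 'M[R]_(n, p) -> R) (Y : 'M[R]_(n, p))
  : 'M[R]_(n, p) :=
  \matrix_(a, i)
    (fine (\int[leb_tuple (n * p)]_t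
             ((tmx t) a i * gdens Y (tmx t) * prior (tmx t))%:E)%E
     / fine (marginal prior Y)).

Definition frob_risk (n p : nat) (est : 'M[R]_(n, p) -> 'M[R]_(n, p))
  (M : 'M[R]_(n, p)) : \bar R :=
  (\int[leb_tuple (n * p)]_t
     (frob2 (est (tmx t) - M) * gdens (tmx t) M)%:E)%E.

Definition is_estimator (n p : nat) (est : 'M[R]_(n, p) -> 'M[R]_(n, p)) :=
  forall a i, measurable_fun [set: (n * p).-tuple R] (fun t => est (tmx t) a i).

Definition frob_inadmissible (n p : nat) (est : 'M[R]_(n, p) -> 'M[R]_(n, p)) :=
  exists est' : 'M[R]_(n, p) -> 'M[R]_(n, p),
    is_estimator est' /\
    (forall M, (frob_risk est' M <= frob_risk est M)%E) /\
    (exists M, (frob_risk est' M < frob_risk est M)%E).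

End Defs.

(* Main.v *)
(* For an estimator [d] and a smooth field [g], Stein's identity turns the risk
   of [d + g] minus that of [d] into the expectation of
   [|g|^2 + 2 g.(d - Y) + 2 div g].  With [g = - Y / (1 + |Y|^2)] this is negative
   as soon as the posterior mean [d] satisfies [Y.(d - Y) >= - k] with
   [n p - k > 5 / 2]; we get [k = p (n - p - 1)], for which [n p - k = p (p + 1) >= 6].

   This bound on [d] comes from two facts about [pi_SVS]: it is homogeneous of
   degree [- k] and superharmonic.  To differentiate it we replace it with the
   smooth bounded prior [det (M^T M + e)^-((n - p - 1) / 2)], which is still
   superharmonic and for which [M.grad pi >= - k pi], and we let [e] tend to [0].
   Superharmonicity also bounds the smoothed prior at [Y] by its value at [Y];
   hence the marginal is finite when [Y] has full rank and the matrices of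
   deficient rank form a null set.

   Integration by parts on the matrix space is obtained by differentiating under
   the integral sign the translation invariance of Lebesgue measure. *)
Require Import Defs.
From HB Require Import structures.
From mathcomp Require Import all_boot all_order all_algebra all_fingroup.
From mathcomp Require Import all_classical all_reals all_analysis.
From mathcomp Require Import measurable_realfun ring lra.
Set Implicit Arguments. Unset Strict Implicit. Unset Printing Implicit Defensive.
Import Order.TTheory GRing.Theory Num.Theory.
Import numFieldNormedType.Exports.
Local Open Scope classical_set_scope.
Local Open Scope ring_scope.

(** * Lebesgue measure on tuples *)

(** The estimator [d] is a quotient of integrals against a singular prior, so its derivatives are
    hard to control. They are never taken: only the explicit field [g] is differentiated, and [d]
    enters through a pointwise bound on [Y.(d - Y)].

    That bound uses integration by parts twice. Once turns the posterior integral of [Y.(M - Y)]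
    into that of [Y.grad pi]. With [Y = M - (M - Y)], the part in [M] is controlled by Euler's
    relation, which gives [k = 2 s p] for [s = (n - p - 1) / 2]; the part in [M - Y] is, after a
    second integration by parts, minus the integral of the Laplacian, hence nonnegative.

    With [q = 1 / (1 + |Y|^2)] and [g = - q Y], the expectation to be signed has an integrand at
    most [q (5 |Y|^2 q - 2 (n p - k))]. The 5 collects 1 from [|g|^2] and 4 from the radial part of
    the divergence; as [|Y|^2 q < 1], the threshold [5 / 2] appears.

    The bounds on [d] are established at full-rank [Y] only. This suffices because risks do not see
    the exceptional null set, but it makes every comparison an almost-everywhere one. *)

Section TupleMeasure.
Context {R : realType}.

Section cons_measure.
Variables (k : nat) (m : {sigma_finite_measure set (k.-tuple R) -> \bar R}).

Let mu := @lebesgue_measure R.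

Let cns (z : measurableTypeR R * k.-tuple R) : k.+1.-tuple R := cons_tuple z.1 z.2.

Let ucns (t : k.+1.-tuple R) := (thead t : measurableTypeR R, [tuple of behead t]).

Let mcns : measurable_fun setT cns.
Proof. exact: measurable_cons. Qed.

Let mucns : measurable_fun setT ucns.
Proof.
by apply/measurable_fun_pairP; split; [exact: measurable_tnth|exact: measurable_behead].
Qed.

Let cnsK : cancel cns ucns.
Proof. by case=> x t; rewrite /ucns /cns /= theadE; congr pair; apply/val_inj. Qed.

(* [leb_tuple] is a bare set function; this is the recursion step that makes it
   a sigma-finite measure. *)
Definition cons_measure := pushforward (mu \x m)%E cns.

Let nu :=
  measure_function_pushforward__canonical__measure_function_Measure (mu \x m)%E mcns.

HB.instance Definition _ := isMeasure.Build _ _ _ cons_measure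
  (measure0 nu) (measure_ge0 nu) (@measure_semi_sigma_additive _ _ _ nu).

Let sf : sigma_finite setT cons_measure.
Proof.
have /sigma_finiteP[F [FT ndF mF]] := sigma_finiteT mu.
have /sigma_finiteP[G [GT ndG mG]] := sigma_finiteT m.
exists (fun i => ucns @^-1` (F i `*` G i)).
  rewrite -preimage_bigcup; apply/esym/seteqP; split => // t _ /=.
  have [i _ Fi] : (\bigcup_i F i) (ucns t).1 by rewrite -FT.
  have [j _ Gj] : (\bigcup_i G i) (ucns t).2 by rewrite -GT.
  exists (maxn i j) => //; split.
    by move: Fi; exact/subsetPset/ndF/leq_maxl.
  by move: Gj; exact/subsetPset/ndG/leq_maxr.
move=> i; have [mFi Fi] := mF i; have [mGi Gi] := mG i; split.
  by rewrite -[X in measurable X]setTI; apply: mucns => //; exact: measurableX.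
rewrite /cons_measure /pushforward.
have -> : cns @^-1` (ucns @^-1` (F i `*` G i)) = F i `*` G i.
  by apply/funext => z; rewrite -[in RHS](cnsK z).
by rewrite product_measure1E// lte_mul_pinfty// ge0_fin_numE.
Qed.

HB.instance Definition _ := Measure_isSigmaFinite.Build _ _ _ cons_measure sf.

(** Valid for every set, measurable or not, because the product measure is by definition the
    integral of the measures of the sections. Hence [leb_tuple] and [lebT] agree as functions, and
    the integrals of the statement can be rewritten with [lebTE]. *)
Lemma cons_measureE (A : set (k.+1.-tuple R)) :
  cons_measure A = (\int[mu]_x m [set t | A (cons_tuple x t)])%E.
Proof.
apply: eq_integral => x _ /=; congr (m _).
by apply/seteqP; split => t /=; rewrite /xsection /= in_setE.
Qed.

End cons_measure.

Lemma leb_tuple_sigma_finite (k : nat) :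
  exists m : {sigma_finite_measure set (k.-tuple R) -> \bar R},
    (m : set _ -> \bar R) = @leb_tuple R k.
Proof.
elim: k => [|k [m mE]].
  exists (\d_([tuple] : 0.-tuple R)).
  by apply/funext => A /=; rewrite /dirac.
exists (cons_measure m); apply/funext => A; rewrite [LHS]cons_measureE /=.
by under eq_integral do rewrite mE.
Qed.

Definition lebT (k : nat) : {sigma_finite_measure set (k.-tuple R) -> \bar R} :=
  projT1 (cid (leb_tuple_sigma_finite k)).

Lemma lebTE k : @leb_tuple R k = lebT k.
Proof. by rewrite /lebT; case: cid. Qed.

Lemma lebT_dirac (f : 0.-tuple R -> \bar R) :
  measurable_fun [set: 0.-tuple R] f -> (\int[lebT 0]_t f t = f [tuple])%E.
Proof.
move=> mf; rewrite -lebTE.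
transitivity (\int[\d_([tuple] : 0.-tuple R)]_t f t)%E.
  by congr integral; apply/funext => A; rewrite /= /dirac.
by rewrite integral_dirac// diracT mul1e.
Qed.

Lemma lebT_consE (k : nat) : lebT k.+1 = cons_measure (lebT k) :> (set _ -> _).
Proof.
apply/funext => A; rewrite cons_measureE -lebTE /=.
by under eq_integral do rewrite lebTE.
Qed.

Lemma lebT_cons (k : nat) (f : k.+1.-tuple R -> \bar R) :
  measurable_fun [set: k.+1.-tuple R] f -> (forall t, 0 <= f t)%E ->
  (\int[lebT k.+1]_t f t =
   \int[lebesgue_measure]_x \int[lebT k]_t f (cons_tuple x t))%E.
Proof.
move=> mf f0.
rewrite lebT_consE ge0_integral_pushforward//; last exact: measurable_cons.
rewrite preimage_setT fubini_tonelli1//; last by move=> z; exact: f0.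
by apply: measurableT_comp => //; exact: measurable_cons.
Qed.

Lemma lebesgue_measure_translate (h : R) (A : set R) : measurable A ->
  lebesgue_measure ((+%R^~ h) @^-1` A) = lebesgue_measure A.
Proof.
move=> mA.
have mh : measurable_fun setT (+%R^~ h : measurableTypeR R -> measurableTypeR R).
  exact: measurable_funD.
pose nu := measure_function_pushforward__canonical__measure_function_Measure
  (@lebesgue_measure R) mh.
apply/esym/(lebesgue_measure_unique (mu := nu)) => //= _ [[a b]] _ <-.
rewrite /pushforward.
have -> : (+%R^~ h) @^-1` `]a, b]%classic = `]a - h, b - h]%classic.
  by apply/seteqP; split => x /=; rewrite !in_itv/= ltrBlDr lerBrDr.
rewrite !lebesgue_measure_itv/= !lte_fin ltrD2r.
by case: ifP => // _; rewrite -!EFinD; congr EFin; ring.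
Qed.

Definition tadd (k : nat) (v t : k.-tuple R) : k.-tuple R :=
  [tuple tnth t i + tnth v i | i < k].

Lemma measurable_tadd (k : nat) (v : k.-tuple R) : measurable_fun setT (tadd v).
Proof.
apply/measurable_fun_tnthP => i.
rewrite (_ : _ \o _ = fun t => tnth t i + tnth v i); last first.
  by apply/funext => t /=; rewrite tnth_mktuple.
by apply: measurable_funD => //; exact: measurable_tnth.
Qed.

(** The induction hypothesis translates each slice by the tail of [v]; one-dimensional invariance,
    in the form of a pushforward, then shifts the head. *)
Lemma lebT_translate (k : nat) (v : k.-tuple R) (A : set (k.-tuple R)) :
  measurable A -> lebT k (tadd v @^-1` A) = lebT k A.
Proof.
elim: k v A => [|k IH] v A mA.
  congr (lebT 0 _); apply/seteqP; split => t; rewrite /preimage /=.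
    by rewrite (tuple0 (tadd v t)) (tuple0 t).
  by rewrite (tuple0 (tadd v t)) (tuple0 t).
rewrite !lebT_consE !cons_measureE.
have mA' : measurable_fun setT (fun x : measurableTypeR R =>
    lebT k [set t | A (cons_tuple x t)]).
  have -> : (fun x : measurableTypeR R => lebT k [set t | A (cons_tuple x t)]) =
      lebT k \o xsection ((fun z : measurableTypeR R * k.-tuple R =>
        cons_tuple z.1 z.2) @^-1` A).
    apply/funext => x /=; congr (lebT k _).
    by apply/seteqP; split => t /=; rewrite /xsection /= in_setE.
  apply: measurable_fun_xsection; rewrite -[X in measurable X]setTI.
  by apply: measurable_cons.
transitivity (\int[@lebesgue_measure R]_x
    (lebT k [set t | A (cons_tuple ((x : R) + thead v)%R t)]))%E.
  apply: eq_integral => x _.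
  rewrite -[RHS](IH [tuple of behead v]); last first.
    rewrite -[X in measurable X]setTI.
    have mc : measurable_fun [set: k.-tuple R]
        (fun t => cons_tuple ((x : R) + thead v) t : k.+1.-tuple R).
      have m1 : measurable_fun [set: k.-tuple R] (fun=> ((x : R) + thead v)) by [].
      have m2 : measurable_fun [set: k.-tuple R] (fun t => t) by exact: measurable_id.
      exact: (measurable_cons m1 m2).
    exact: (mc measurableT _ mA).
  congr (lebT k _); rewrite /preimage; apply/funext => t /=; congr A.
  apply: eq_from_tnth => i; rewrite tnth_mktuple.
  have [j ->|->] := fintype.unliftP ord0 i; last by rewrite !tnth0.
  by rewrite !tnthS tnth_mktuple !(tnth_nth 0) /= nth_behead.
transitivity (\int[pushforward lebesgue_measure (+%R^~ (thead v) : measurableTypeR R -> measurableTypeR R)]_x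
    (lebT k [set t | A (cons_tuple x t)]))%E.
  rewrite ge0_integral_pushforward//; first exact: measurable_funD.
apply: eq_measure_integral => [|mh B mB _]; first exact: measurable_funD.
exact: lebesgue_measure_translate.
Qed.

Lemma ge0_integral_lebT_translate (k : nat) (v : k.-tuple R) (f : k.-tuple R -> \bar R) :
  measurable_fun [set: k.-tuple R] f -> (forall t, 0 <= f t)%E ->
  (\int[lebT k]_t f (tadd v t) = \int[lebT k]_t f t)%E.
Proof.
move=> mf f0.
rewrite -(@ge0_integral_pushforward _ _ _ _ _ (tadd v) (measurable_tadd v) (lebT k) setT f)//.
apply: eq_measure_integral => [|mh B mB _]; first exact: measurable_tadd.
exact: lebT_translate.
Qed.

Lemma integral_lebT_translate (k : nat) (v : k.-tuple R) (f : k.-tuple R -> \bar R) :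
  measurable_fun [set: k.-tuple R] f ->
  (\int[lebT k]_t f (tadd v t) = \int[lebT k]_t f t)%E.
Proof.
move=> mf; rewrite (_ : (fun t => f (tadd v t)) = f \o tadd v)//.
rewrite integralE [in RHS]integralE funepos_comp funeneg_comp; congr (_ - _)%E.
  exact: (ge0_integral_lebT_translate v (measurable_funepos mf) (funepos_ge0 f)).
exact: (ge0_integral_lebT_translate v (measurable_funeneg mf) (funeneg_ge0 f)).
Qed.

Lemma integrable_gauss1 (c : R) : 0 < c ->
  (\int[@lebesgue_measure R]_x (expR (- (c * x ^+ 2)))%:E < +oo)%E.
Proof.
(* The standard deviation for which the unnormalized normal density is [expR (- (c * x ^+ 2))]. *)
move=> c0; pose s := Num.sqrt (c *+ 2)^-1.
have s0 : s != 0 by rewrite gt_eqF// sqrtr_gt0 invr_gt0 mulrn_wgt0.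
have /integrableP[_] := integrableZl measurableT (normal_peak s)^-1
  (integrable_normal_pdf 0 s).
apply: le_lt_trans; apply: ge0_le_integral => //.
- apply/measurable_EFinP; apply: measurableT_comp => //.
  by apply: measurableT_comp => //; apply: measurable_funM => //; exact: measurable_funX.
- apply: measurableT_comp => //; apply/measurable_EFinP; apply: measurable_funM => //.
  exact: measurable_normal_pdf.
move=> x _; rewrite -EFinM lee_fin normal_pdfE// mulKf ?gt_eqF ?normal_peak_gt0//.
have s2 : s ^+ 2 = (c *+ 2)^-1 by rewrite sqr_sqrtr// invr_ge0 mulrn_wge0// ltW.
rewrite ger0_norm ?normal_fun_ge0// /normal_fun ler_expR subr0 s2.
by rewrite le_eqVlt; apply/orP; left; apply/eqP; field; rewrite gt_eqF.
Qed.

Lemma measurable_tnth_sqr (k : nat) (c : R) :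
  measurable_fun [set: k.-tuple R]
    (fun t => (expR (- (c * \sum_(i < k) tnth t i ^+ 2)))%:E).
Proof.
apply/measurable_EFinP; apply: measurableT_comp => //; apply: measurableT_comp => //.
apply: measurable_funM => //; apply: measurable_sum => i.
by apply: measurable_funX; exact: measurable_tnth.
Qed.

Lemma integrable_gaussT (k : nat) (c : R) : 0 < c ->
  (\int[lebT k]_t (expR (- (c * \sum_(i < k) tnth t i ^+ 2)))%:E < +oo)%E.
Proof.
move=> c0; elim: k => [|k IH].
  rewrite lebT_dirac ?ltry//; exact: measurable_tnth_sqr.
rewrite lebT_cons; [|exact: measurable_tnth_sqr|by move=> t; rewrite lee_fin expR_ge0].
set J := integral (lebT k) _ _ in IH.
have J0 : (0 <= J)%E by apply: integral_ge0 => t _; rewrite lee_fin expR_ge0.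
have -> : (\int[lebesgue_measure]_x
   \int[lebT k]_t
      (expR (- (c * \sum_(i < k.+1) tnth (cons_tuple x t) i ^+ 2)))%:E =
   \int[lebesgue_measure]_x ((expR (- (c * x ^+ 2)))%:E * J))%E.
  apply: eq_integral => x _; rewrite -ge0_integralZl//; last exact: measurable_tnth_sqr.
  apply: eq_integral => t _; rewrite -EFinM -expRD big_ord_recl tnth0 mulrDr opprD.
  by under eq_bigr do rewrite tnthS.
rewrite ge0_integralZr//.
- have G0 : (0 <= \int[@lebesgue_measure R]_x (expR (- (c * x ^+ 2)))%:E)%E.
    by apply: integral_ge0 => x _; rewrite lee_fin expR_ge0.
  by rewrite lte_mul_pinfty// ge0_fin_numE// integrable_gauss1.
- apply/measurable_EFinP; apply: measurableT_comp => //.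
  by apply: measurableT_comp => //; apply: measurable_funM => //; exact: measurable_funX.
Qed.

End TupleMeasure.

(** * Derivatives of matrix functions *)

Section MatrixCalculus.
Context {R : realType}.

Lemma is_derive_bigsum (I : Type) (r : seq I) (P : pred I) (F : I -> R -> R)
    (dF : I -> R) (x : R) :
  (forall i, P i -> is_derive x 1 (F i) (dF i)) ->
  is_derive x 1 (fun h => \sum_(i <- r | P i) F i h) (\sum_(i <- r | P i) dF i).
Proof.
move=> dFx; elim: r => [|i r IH].
  rewrite big_nil; under eq_fun do rewrite big_nil.
  exact: is_derive_cst.
rewrite big_cons; under eq_fun do rewrite big_cons.
case: ifP => // Pi; exact: (is_deriveD (dFx _ Pi) IH).
Qed.

Lemma is_derive_mul (f g : R -> R) (x df dg : R) :
  is_derive x 1 f df -> is_derive x 1 g dg ->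
  is_derive x 1 (fun h => f h * g h) (df * g x + f x * dg).
Proof.
move=> hf hg; have H := is_deriveM hf hg; apply: (is_derive_eq H).
by rewrite /GRing.scale/=; ring.
Qed.

Lemma is_derive_mull (c : R) (f : R -> R) (x df : R) :
  is_derive x 1 f df -> is_derive x 1 (fun h => c * f h) (c * df).
Proof. by move=> hf; exact: (is_deriveZ c hf). Qed.

Lemma is_derive_bigprod (I : eqType) (r : seq I) (F : I -> R -> R)
    (dF : I -> R) (x : R) : uniq r ->
  (forall i, is_derive x 1 (F i) (dF i)) ->
  is_derive x 1 (fun h => \prod_(i <- r) F i h)
    (\sum_(i <- r) dF i * \prod_(j <- r | i != j) F j x).
Proof.
move=> + dFx; elim: r => [|i r IH] /=.
  move=> _; rewrite big_nil; under eq_fun do rewrite big_nil.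
  exact: is_derive_cst.
case/andP => ir ur; under eq_fun do rewrite big_cons.
apply: is_derive_eq; first exact: (is_derive_mul (dFx i) (IH ur)).
rewrite big_cons; congr (_ + _).
  rewrite big_cons eqxx /= big_seq_cond [in RHS]big_seq_cond.
  congr (_ * _); apply: eq_bigl => j; case: (boolP (j \in r)) => //= jr.
  by apply/esym; apply: contraNneq ir => ->.
rewrite big_distrr /= big_seq_cond [in RHS]big_seq_cond.
apply: eq_bigr => j; rewrite andbT => jr; rewrite big_cons.
by rewrite (_ : (j != i) = true) 1?mulrCA//; apply: contraNneq ir => <-.
Qed.

Definition mx_derive (m n : nat) (x : R) (A : R -> 'M[R]_(m, n)) (dA : 'M[R]_(m, n)) :=
  forall i j, is_derive x 1 (fun h => A h i j) (dA i j).

Lemma mx_derive_cst m n x (A : 'M[R]_(m, n)) : mx_derive x (fun=> A) 0.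
Proof. by move=> i j; rewrite mxE; exact: is_derive_cst. Qed.

Lemma mx_derive_tr m n x (A : R -> 'M[R]_(m, n)) dA :
  mx_derive x A dA -> mx_derive x (fun h => (A h)^T) dA^T.
Proof. by move=> hA i j; rewrite mxE; under eq_fun do rewrite mxE; exact: hA. Qed.

Lemma mx_deriveD m n x (A B : R -> 'M[R]_(m, n)) dA dB :
  mx_derive x A dA -> mx_derive x B dB -> mx_derive x (fun h => A h + B h) (dA + dB).
Proof.
move=> hA hB i j; rewrite mxE; under eq_fun do rewrite mxE.
exact: (is_deriveD (hA i j) (hB i j)).
Qed.

Lemma mx_deriveM m n p x (A : R -> 'M[R]_(m, n)) (B : R -> 'M[R]_(n, p)) dA dB :
  mx_derive x A dA -> mx_derive x B dB ->
  mx_derive x (fun h => A h *m B h) (dA *m B x + A x *m dB).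
Proof.
move=> hA hB i j; rewrite !mxE -big_split/=; under eq_fun do rewrite mxE.
by apply: is_derive_bigsum => k _; exact: is_derive_mul.
Qed.

Lemma mx_derive_line m n x (M E : 'M[R]_(m, n)) : mx_derive x (fun h => M + h *: E) E.
Proof.
move=> i j; under eq_fun do rewrite !mxE.
have H := is_deriveD (is_derive_cst (M i j) x 1)
  (is_derive_mul (is_derive_id x 1) (is_derive_cst (E i j) x 1)).
by apply: (is_derive_eq H); rewrite /=; ring.
Qed.

(** The product rule is applied to each term of the Leibniz formula; collecting the permutations by
    the image of the differentiated row recovers the cofactors. *)
Lemma is_derive_det p x (A : R -> 'M[R]_p) dA :
  mx_derive x A dA ->
  is_derive x 1 (fun h => \det (A h)) (\sum_i \sum_j dA i j * cofactor (A x) i j).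
Proof.
move=> hA; rewrite /determinant.
apply: is_derive_eq.
  apply: is_derive_bigsum => s _; apply: is_derive_mull.
  apply: is_derive_bigprod; first exact: index_enum_uniq.
  by move=> i; exact: hA.
under eq_bigr do rewrite big_distrr/=.
rewrite exchange_big/=; apply: eq_bigr => i _.
rewrite (partition_big (fun s : 'S_p => s i) xpredT)//=.
apply: eq_bigr => j _; rewrite expand_cofactor big_distrr/=.
by apply: eq_bigr => s /eqP <-; rewrite mulrCA.
Qed.

Lemma is_derive_det_unit p x (A : R -> 'M[R]_p) dA :
  mx_derive x A dA -> A x \in unitmx ->
  is_derive x 1 (fun h => \det (A h)) (\det (A x) * \tr (invmx (A x) *m dA)).
Proof.
move=> hA uA; apply: is_derive_eq; first exact: is_derive_det hA.
rewrite /invmx uA -scalemxAl mxtraceZ mulrA mulfV -?unitfE -?unitmxE// mul1r.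
rewrite exchange_big /mxtrace; apply: eq_bigr => j _; rewrite mxE.
by apply: eq_bigr => i _; rewrite mxE mulrC.
Qed.

Lemma mx_derive_inv p x (A : R -> 'M[R]_p) dA :
  mx_derive x A dA -> (forall h, A h \in unitmx) ->
  mx_derive x (fun h => invmx (A h)) (- (invmx (A x) *m dA *m invmx (A x))).
Proof.
move=> hA uA.
(* The cofactor formula is used only for the existence of a derivative; the expression it gives is
   discarded. *)
have [dT hT] : exists dT, mx_derive x (fun h => invmx (A h)) dT.
  suff H i j : exists d, is_derive x 1 (fun h => invmx (A h) i j) d.
    exists (\matrix_(i, j) projT1 (cid (H i j))) => i j; rewrite mxE; by case: cid.
  have hm : mx_derive x (fun h => row' j (col' i (A h))) (row' j (col' i dA)).
    by move=> k l; rewrite !mxE; under eq_fun do rewrite !mxE; exact: hA.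
  have hc := is_derive_mull ((-1) ^+ (j + i)) (is_derive_det hm).
  have d0 : \det (A x) != 0 by rewrite -unitfE -unitmxE.
  have hp := is_derive_mul (is_deriveV d0 (is_derive_det hA)) hc.
  have E : (fun h => invmx (A h) i j) = (fun h => (\det (A h))^-1 * cofactor (A h) j i).
    by apply/funext => h; rewrite /invmx uA !mxE.
  by eexists; rewrite E; exact: hp.
(* the value follows by differentiating [A h *m invmx (A h) = 1%:M] *)
suff -> : - (invmx (A x) *m dA *m invmx (A x)) = dT by [].
have h1 := mx_deriveM hA hT.
have {h1} h1 : mx_derive x (fun=> 1%:M) (dA *m invmx (A x) + A x *m dT).
  move=> i j; have := h1 i j; congr (is_derive _ _ _ _).
  by apply/funext => h; rewrite mulmxV.
have E : dA *m invmx (A x) + A x *m dT = 0.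
  apply/matrixP => i j; have [_ <-] := h1 i j; have [_ <-] := mx_derive_cst x 1%:M i j.
  by [].
move/eqP: E; rewrite addrC addr_eq0 => /eqP E.
by rewrite -mulmxA -mulmxN -E mulKmx.
Qed.

End MatrixCalculus.

(** * The regularized Gram matrix *)

Section RegularizedGram.
Context {R : realType}.
Variables (n p : nat).
Implicit Types (M E : 'M[R]_(n, p)) (e : R).

Definition rgram e M : 'M[R]_p := M^T *m M + e%:M.
Definition rinv e M : 'M[R]_p := invmx (rgram e M).
(** Up to the factor [- (2 * s)], this is the gradient of the logarithm of the regularized prior. *)
Definition rquot e M : 'M[R]_(n, p) := M *m rinv e M.

Lemma frob2_tr (m k : nat) (A : 'M[R]_(m, k)) : frob2 A = \tr (A^T *m A).
Proof.
rewrite /frob2 /mxtrace exchange_big; apply: eq_bigr => i _; rewrite mxE.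
by apply: eq_bigr => a _; rewrite mxE expr2.
Qed.

Lemma frob2_ge0 (m k : nat) (A : 'M[R]_(m, k)) : 0 <= frob2 A.
Proof. by do 2 (apply: sumr_ge0 => ? _); exact: sqr_ge0. Qed.

Lemma sqr_le_frob2 (m k : nat) (A : 'M[R]_(m, k)) a i : A a i ^+ 2 <= frob2 A.
Proof.
rewrite /frob2 (bigD1 a)//= (bigD1 i)//= -addrA lerDl addr_ge0//.
  by apply: sumr_ge0 => ? _; exact: sqr_ge0.
by do 2 (apply: sumr_ge0 => ? _); exact: sqr_ge0.
Qed.

(** A row [v] in the kernel satisfies [|M v^T|^2 + e |v|^2 = 0], so it vanishes. *)
Lemma rgram_unit e M : 0 < e -> rgram e M \in unitmx.
Proof.
move=> e0; rewrite -row_free_unit -kermx_eq0; apply/eqP/row_matrixP => k.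
rewrite row0; move: (row k _) (row_sub k (kermx (rgram e M))) => v.
move=> /sub_kermxP vS; apply/eqP; rewrite -[_ == _]/(_) -subr_eq0 subr0.
have : \tr (v *m rgram e M *m v^T) = 0 by rewrite vS mul0mx mxtrace0.
rewrite /rgram mulmxDr mulmxDl mxtraceD.
have -> : v *m (M^T *m M) *m v^T = (M *m v^T)^T *m (M *m v^T).
  by rewrite trmx_mul trmxK !mulmxA.
rewrite mul_mx_scalar -scalemxAl mxtraceZ -[in X in _ + e * \tr (X *m _) = _](trmxK v) -!frob2_tr => /eqP.
rewrite paddr_eq0 ?frob2_ge0 ?mulr_ge0 ?frob2_ge0 ?(ltW e0)// => /andP[_].
rewrite mulf_eq0 gt_eqF//= => /eqP v0.
apply/eqP/matrixP => i j; rewrite mxE.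
have := sqr_le_frob2 v^T j i; rewrite v0 mxE => vij.
by apply/eqP; rewrite -sqrf_eq0 eq_le vij sqr_ge0.
Qed.

Lemma rgram_tr e M : (rgram e M)^T = rgram e M.
Proof. by rewrite /rgram raddfD/= trmx_mul trmxK tr_scalar_mx. Qed.

Lemma rinv_tr e M : (rinv e M)^T = rinv e M.
Proof. by rewrite /rinv trmx_inv rgram_tr. Qed.

(** Comes from [S = S (M^T M + e) S] for the symmetric matrix [S = rinv e M]. Writing the inverse as
    a sum of two Gram matrices gives the positivity and the bounds below, which depend on [e] but
    not on [M]. *)
Lemma rinvE e M : 0 < e ->
  rinv e M = (rquot e M)^T *m rquot e M + e *: ((rinv e M)^T *m rinv e M).
Proof.
move=> e0; rewrite /rquot trmx_mul rinv_tr.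
transitivity (rinv e M *m rgram e M *m rinv e M).
  by rewrite mulVmx ?rgram_unit// mul1mx.
by rewrite [in LHS]/rgram mulmxDr mulmxDl mul_mx_scalar -scalemxAl !mulmxA.
Qed.

Lemma mxtrace_rinv e M : 0 < e ->
  \tr (rinv e M) = frob2 (rquot e M) + e * frob2 (rinv e M).
Proof. by move=> e0; rewrite {1}(rinvE _ e0) mxtraceD mxtraceZ -!frob2_tr. Qed.

(** The matrix [rquot e M *m M^T] is the hat matrix of ridge regression. Its trace falls short of
    [p] by [e * \tr (rinv e M)]; this defect has the favourable sign both in [sum_rhess_le0] and in
    [inner_rgrad_ge]. *)
Lemma mxtrace_rquot e M : 0 < e ->
  \tr (rquot e M *m M^T) = p%:R - e * \tr (rinv e M).
Proof.
move=> e0; rewrite mxtrace_mulC /rquot mulmxA.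
have -> : M^T *m M = rgram e M - e%:M by rewrite /rgram addrK.
rewrite mulmxBl mulmxV ?rgram_unit// mul_scalar_mx raddfB/= mxtrace1 mxtraceZ//.
Qed.

Lemma rinv_diag e M i : 0 < e ->
  rinv e M i i = \sum_a rquot e M a i ^+ 2 + e * \sum_j rinv e M j i ^+ 2.
Proof.
move=> e0; rewrite {1}(rinvE _ e0) !mxE; congr (_ + _ * _).
  by apply: eq_bigr => a _; rewrite mxE expr2.
by apply: eq_bigr => a _; rewrite mxE expr2.
Qed.

Lemma rinv_diag_ge0 e M i : 0 < e -> 0 <= rinv e M i i.
Proof.
move=> e0; rewrite rinv_diag// addr_ge0//.
  by apply: sumr_ge0 => ? _; exact: sqr_ge0.
by rewrite mulr_ge0 ?(ltW e0)//; apply: sumr_ge0 => ? _; exact: sqr_ge0.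
Qed.

Lemma rinv_col_le e M i j : 0 < e -> e * rinv e M j i ^+ 2 <= rinv e M i i.
Proof.
move=> e0; rewrite rinv_diag// -[leLHS]add0r lerD//.
  by apply: sumr_ge0 => ? _; exact: sqr_ge0.
rewrite ler_pM2l// (bigD1 j)//= lerDl.
by apply: sumr_ge0 => ? _; exact: sqr_ge0.
Qed.

(** Taking [j = i] in [rinv_col_le], the diagonal entry [r] satisfies [e r^2 <= r]. *)
Lemma rinv_diag_le e M i : 0 < e -> rinv e M i i <= e^-1.
Proof.
move=> e0; have := rinv_col_le M i i e0; have := rinv_diag_ge0 M i e0.
rewrite le_eqVlt => /predU1P[<- _|r0]; first by rewrite invr_ge0 ltW.
by rewrite expr2 mulrA -[leRHS]mul1r ler_pM2r// -ler_pdivlMl// mulr1.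
Qed.

Lemma rinv_le e M i j : 0 < e -> `|rinv e M i j| <= e^-1.
Proof.
move=> e0; have ie : 0 <= e^-1 by rewrite invr_ge0 ltW.
rewrite -(ler_pXn2r (n := 2))// ?nnegrE// real_normK ?num_real//.
have := le_trans (rinv_col_le M j i e0) (rinv_diag_le M j e0).
by rewrite -ler_pdivlMl// -expr2.
Qed.

Lemma rquot_le e M a i : 0 < e -> rquot e M a i ^+ 2 <= e^-1.
Proof.
move=> e0; apply: le_trans (rinv_diag_le M i e0); rewrite rinv_diag//.
rewrite (bigD1 a)//= -addrA lerDl addr_ge0//.
  by apply: sumr_ge0 => ? _; exact: sqr_ge0.
by rewrite mulr_ge0 ?(ltW e0)//; apply: sumr_ge0 => ? _; exact: sqr_ge0.
Qed.

Lemma rhat_diag_ge0 e M a : 0 < e -> 0 <= (rquot e M *m M^T) a a.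
Proof.
move=> e0; rewrite /rquot {1}(rinvE _ e0) mulmxDr mulmxDl mxE.
rewrite -scalemxAr -scalemxAl [X in _ + X]mxE.
have P (k : nat) (B : 'M[R]_(k, p)) : 0 <= (M *m (B^T *m B) *m M^T) a a.
  rewrite (_ : M *m _ *m _ = (B *m M^T)^T *m (B *m M^T)); last first.
    by rewrite trmx_mul trmxK !mulmxA.
  by rewrite mxE; apply: sumr_ge0 => j _; rewrite mxE -expr2 sqr_ge0.
by rewrite addr_ge0// mulr_ge0// ltW.
Qed.

Lemma rhat_diag_le e M a : 0 < e -> (rquot e M *m M^T) a a <= p%:R.
Proof.
move=> e0; apply: (@le_trans _ _ (\tr (rquot e M *m M^T))).
  rewrite /mxtrace (bigD1 a)//= lerDl; apply: sumr_ge0 => b _.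
  exact: rhat_diag_ge0.
rewrite mxtrace_rquot// gerBl mulr_ge0 ?(ltW e0)//.
by apply: sumr_ge0 => i _; exact: rinv_diag_ge0.
Qed.

End RegularizedGram.

(** * Sign and monotonicity of the regularized determinant; the prior along lines *)

Section RegularizedPrior.
Context {R : realType}.
Variables (n p : nat).
Implicit Types (M E : 'M[R]_(n, p)) (e : R).

Lemma derivable_continuous (f df : R -> R) :
  (forall x : R, is_derive x 1 f (df x)) -> continuous f.
Proof.
move=> h x; apply: differentiable_continuous; apply/derivable1_diffP.
by case: (h x).
Qed.

Lemma continuous_det_line (k : nat) (A B : 'M[R]_k) :
  continuous (fun u : R => \det (A + u *: B)).
Proof.
apply: derivable_continuous => x; apply: is_derive_det; exact: mx_derive_line.
Qed.

(** Gives the sign of a determinant by deformation through invertible matrices, in place of a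
    diagonalization. *)
Lemma pos_of_nonvanishing (f : R -> R) (a b : R) : a <= b -> continuous f ->
  (forall x, a <= x <= b -> f x != 0) -> (0 < f a) = (0 < f b).
Proof.
move=> ab cf f0.
have fa := f0 a; rewrite lexx ab in fa; have {}fa := fa isT.
have fb := f0 b; rewrite lexx ab in fb; have {}fb := fb isT.
have cw : {within `[a, b], continuous f} by exact: continuous_subspaceT.
suff H : ~~ (Num.min (f a) (f b) <= 0 <= Num.max (f a) (f b)).
  move: H; rewrite ge_min le_max !le_eqVlt (negbTE fa) (negbTE fb).
  rewrite [0 == f a]eq_sym [0 == f b]eq_sym (negbTE fa) (negbTE fb)/=.
  by case: ltgtP fa => // ha _; case: ltgtP fb => // hb _.
apply/negP => /(IVT ab cw)[c]; rewrite in_itv/= => /f0 fc.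
by move/eqP; rewrite (negbTE fc).
Qed.

Lemma rgram_line e M : rgram e M = M^T *m M + e *: 1%:M.
Proof. by rewrite /rgram scalemx1. Qed.

Lemma det_rgram_neq0 e M : 0 < e -> \det (rgram e M) != 0.
Proof. by move=> e0; rewrite -unitfE -unitmxE rgram_unit. Qed.

(** The segment from [e%:M] to [rgram e M] consists of invertible matrices, since its point at [u]
    is the regularized Gram matrix of [Num.sqrt u *: M]. *)
Lemma det_rgram_gt0 e M : 0 < e -> 0 < \det (rgram e M).
Proof.
move=> e0.
have := @pos_of_nonvanishing (fun u : R => \det (e%:M + u *: (M^T *m M))) 0 1 ler01
  (@continuous_det_line _ _ _).
rewrite scale0r addr0 scale1r addrC -/(rgram e M) det_scalar exprn_gt0// => <- //.
move=> u /andP[u0 _].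
suff -> : e%:M + u *: (M^T *m M) = rgram e (Num.sqrt u *: M) by exact: det_rgram_neq0.
rewrite /rgram addrC; congr (_ + _).
by rewrite -scalemxAr [X in _ *: (X *m _)]linearZ/= -scalemxAl scalerA -expr2 sqr_sqrtr.
Qed.

(** A negative value would persist along [M^T *m M + x *: 1%:M], whose determinant does not vanish
    for [0 < x] and is positive at [x = 1]. *)
Lemma det_gram_ge0 M : 0 <= \det (M^T *m M).
Proof.
rewrite leNgt; apply/negP => d0.
have H x : 0 <= x <= 1 -> \det (M^T *m M + x *: 1%:M) != 0.
  case/andP; rewrite le_eqVlt => /predU1P[<- _|x0 _].
    by rewrite scale0r addr0 lt_eqF.
  by rewrite -rgram_line det_rgram_neq0.
have := pos_of_nonvanishing ler01 (@continuous_det_line _ (M^T *m M) 1%:M) H.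
by rewrite scale0r addr0 -rgram_line det_rgram_gt0// ltNge ltW.
Qed.

Lemma rgram0 M : rgram 0 M = M^T *m M.
Proof. by rewrite rgram_line scale0r addr0. Qed.

(** By Jacobi's formula the derivative is the determinant times the trace of the inverse, both
    nonnegative. It is needed on the open interval only, which admits [e1 = 0] even when the Gram
    matrix is singular. *)
Lemma le_det_rgram M e1 e2 : 0 <= e1 -> e1 <= e2 ->
  \det (rgram e1 M) <= \det (rgram e2 M).
Proof.
move=> e10 e12; pose f (u : R) := \det (M^T *m M + u *: 1%:M).
rewrite !rgram_line -/(f e1) -/(f e2).
have df (x : R) : 0 < x -> is_derive x 1 f (\det (rgram x M) * \tr (rinv x M)).
  move=> x0; rewrite /rinv -[X in \tr X]mulmx1 rgram_line.
  by apply: is_derive_det_unit; [exact: mx_derive_line|rewrite -rgram_line rgram_unit].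
apply: (@ger0_derive1_le_cc _ f e1 e2) => //.
- by move=> x; rewrite in_itv/= => /andP[/(le_lt_trans e10) /df []].
- move=> x; rewrite in_itv/= => /andP[/(le_lt_trans e10) x0 _].
  rewrite derive1E; have [_ ->] := df _ x0.
  rewrite mulr_ge0 ?(ltW (det_rgram_gt0 _ _))//.
  by apply: sumr_ge0 => i _; exact: rinv_diag_ge0.
- exact/continuous_subspaceT/continuous_det_line.
- by rewrite in_itv/= lexx.
- by rewrite in_itv/= lexx andbT.
Qed.

Variable s : R.

(* [rprior 0] is the singular prior; where [M] is rank deficient it takes the
   junk value [0 `^ (- s) = 0] and not [+oo]. *)
Definition rprior e M : R := (\det (rgram e M)) `^ (- s).

Lemma rprior_gt0 e M : 0 < e -> 0 < rprior e M.
Proof. by move=> e0; rewrite powR_gt0 ?det_rgram_gt0. Qed.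

Definition inner (A B : 'M[R]_(n, p)) : R := \sum_a \sum_i A a i * B a i.

Lemma mx_derive_rgram e M E (x : R) :
  mx_derive x (fun h => rgram e (M + h *: E))
    (E^T *m (M + x *: E) + (M + x *: E)^T *m E).
Proof.
rewrite -[X in mx_derive _ _ X]addr0; apply: mx_deriveD; last exact: mx_derive_cst.
apply: mx_deriveM; last exact: mx_derive_line.
by apply: mx_derive_tr; exact: mx_derive_line.
Qed.

Lemma tr_rinv_inner e M E :
  \tr (rinv e M *m (E^T *m M + M^T *m E)) = 2 * inner (rquot e M) E.
Proof.
have H : \tr (rinv e M *m (M^T *m E)) = inner (rquot e M) E.
  rewrite /inner exchange_big /mxtrace; apply: eq_bigr => i _.
  rewrite mulmxA mxE; apply: eq_bigr => a _; congr (_ * _).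
  by rewrite -[in LHS](rinv_tr e M) -trmx_mul mxE.
rewrite mulmxDr mxtraceD H -mxtrace_tr !trmx_mul trmxK rinv_tr mxtrace_mulC H.
by ring.
Qed.

Lemma is_derive_rprior e M E (x : R) : 0 < e ->
  is_derive x 1 (fun h => rprior e (M + h *: E))
    (- (2 * s) * (rprior e (M + x *: E) * inner (rquot e (M + x *: E)) E)).
Proof.
move=> e0; set X := M + x *: E.
have d0 : 0 < \det (rgram e X) by exact: det_rgram_gt0.
have hd := is_derive_det_unit (mx_derive_rgram e M E x) (rgram_unit _ e0).
have hp := is_derive1_powR (- s) d0.
have := is_derive1_comp hp hd; move=> H; apply: (is_derive_eq H).
rewrite -/X -/(rinv e X) tr_rinv_inner /rprior powRB; last first.
  by apply/implyP => _; rewrite gt_eqF.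
rewrite powRr1 ?ltW//.
by field; rewrite gt_eqF.
Qed.

Lemma mx_derive_rinv e M E (x : R) : 0 < e ->
  mx_derive x (fun h => rinv e (M + h *: E))
    (- (rinv e (M + x *: E) *m (E^T *m (M + x *: E) + (M + x *: E)^T *m E) *m
        rinv e (M + x *: E))).
Proof.
move=> e0; apply: mx_derive_inv; first exact: mx_derive_rgram.
by move=> h; exact: rgram_unit.
Qed.

Definition drquot e M E : 'M[R]_(n, p) :=
  E *m rinv e M - rquot e M *m (E^T *m M + M^T *m E) *m rinv e M.

Lemma mx_derive_rquot e M E (x : R) : 0 < e ->
  mx_derive x (fun h => rquot e (M + h *: E)) (drquot e (M + x *: E) E).
Proof.
move=> e0; have H := mx_deriveM (mx_derive_line x M E) (mx_derive_rinv M E x e0).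
suff -> : drquot e (M + x *: E) E = E *m rinv e (M + x *: E) +
  (M + x *: E) *m - (rinv e (M + x *: E) *m (E^T *m (M + x *: E) +
    (M + x *: E)^T *m E) *m rinv e (M + x *: E)) by [].
by rewrite /drquot mulmxN !mulmxA.
Qed.

End RegularizedPrior.

(** * Superharmonicity, Euler's relation and uniform bounds for the regularized prior; its limit *)

Section PriorDerivatives.
Context {R : realType}.
Variables (n p : nat) (s : R).
Hypothesis s0 : 0 < s.
Implicit Types (M E : 'M[R]_(n, p)) (e : R).
Notation rprior := (@rprior R n p s).

Lemma inner_delta (A : 'M[R]_(n, p)) a i : inner A (delta_mx a i) = A a i.
Proof.
rewrite /inner (bigD1 a)//= (bigD1 i)//= mxE !eqxx mulr1 !big1 ?addr0//.
  by move=> b ba; apply: big1 => j _; rewrite mxE (negbTE ba) mulr0.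
by move=> j ji; rewrite mxE (negbTE ji) andbF mulr0.
Qed.

Definition rgrad e M : 'M[R]_(n, p) := (- (2 * s) * rprior e M) *: rquot e M.

(* Only the diagonal of the Hessian: [rhess e M a i] is the second derivative in
   the direction [delta_mx a i]. *)
Definition rhess e M : 'M[R]_(n, p) := \matrix_(a, i)
  (- (2 * s) * rprior e M * ((1 - (rquot e M *m M^T) a a) * rinv e M i i
     - (2 * s + 1) * rquot e M a i ^+ 2)).

Lemma is_derive_rprior_delta e M a i (x : R) : 0 < e ->
  is_derive x 1 (fun h => rprior e (M + h *: delta_mx a i))
    (rgrad e (M + x *: delta_mx a i) a i).
Proof.
move=> e0; have H := is_derive_rprior s M (delta_mx a i) x e0; apply: (is_derive_eq H).
by rewrite inner_delta /rgrad [in RHS]mxE mulrA.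
Qed.

Lemma delta_mul (m k l : nat) (A : 'M[R]_(k, l)) (a b : 'I_m) (i : 'I_k) j :
  (delta_mx a i *m A) b j = (b == a)%:R * A i j.
Proof.
rewrite mxE (bigD1 i)//= mxE eqxx andbT big1 ?addr0// => k' ki.
by rewrite mxE (negbTE ki) andbF mul0r.
Qed.

Lemma mul_delta (m k l : nat) (A : 'M[R]_(m, k)) (a : 'I_k) (i j : 'I_l) b :
  (A *m delta_mx a i) b j = A b a * (j == i)%:R.
Proof.
rewrite mxE (bigD1 a)//= mxE eqxx big1 ?addr0// => k' ki.
by rewrite mxE (negbTE ki) mulr0.
Qed.

Lemma drquot_delta e M a i :
  drquot e M (delta_mx a i) a i =
  rinv e M i i - rquot e M a i ^+ 2 - (rquot e M *m M^T) a a * rinv e M i i.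
Proof.
have h1 : (delta_mx a i *m rinv e M) a i = rinv e M i i.
  by rewrite delta_mul eqxx mul1r.
have h2 : (rquot e M *m ((delta_mx a i)^T *m M) *m rinv e M) a i = rquot e M a i ^+ 2.
  rewrite trmx_delta !mulmxA -mulmxA -/(rquot e M) mxE (bigD1 a)//= big1 ?addr0.
    by rewrite mul_delta eqxx mulr1 expr2.
  by move=> b ba; rewrite mul_delta (negbTE ba) mulr0 mul0r.
have h3 : (rquot e M *m (M^T *m delta_mx a i) *m rinv e M) a i =
    (rquot e M *m M^T) a a * rinv e M i i.
  rewrite mulmxA mxE (bigD1 i)//= mul_delta eqxx mulr1 big1 ?addr0// => j ji.
  by rewrite mul_delta (negbTE ji) mulr0 mul0r.
rewrite /drquot mulmxDr mulmxDl mxE h1 mxE mxE h2 h3; ring.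
Qed.

Lemma is_derive_rgrad_delta e M a i (x : R) : 0 < e ->
  is_derive x 1 (fun h => rgrad e (M + h *: delta_mx a i) a i)
    (rhess e (M + x *: delta_mx a i) a i).
Proof.
move=> e0; under eq_fun do rewrite mxE.
have H1 := is_derive_mull (- (2 * s)) (is_derive_rprior_delta M a i x e0).
have H2 := mx_derive_rquot M (delta_mx a i) x e0 a i.
apply: (is_derive_eq (is_derive_mul H1 H2)).
by rewrite drquot_delta !mxE; ring.
Qed.

(** Write [S] for [rinv e M] and [Q] for [rquot e M]. The Laplacian is [- 2 s pi] times
    [(n - p + e tr S) tr S - (2 s + 1) |Q|^2]. Since [|Q|^2 <= tr S] and [2 s + 1 <= n - p], this
    factor is at least [e (tr S)^2]. *)
Lemma sum_rhess_le0 e M : 0 < e -> 2 * s + 1 <= n%:R - p%:R ->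
  \sum_a \sum_i rhess e M a i <= 0.
Proof.
move=> e0 snp.
have -> : \sum_a \sum_i rhess e M a i = - (2 * s) * rprior e M *
    ((n%:R - \tr (rquot e M *m M^T)) * \tr (rinv e M) -
     (2 * s + 1) * frob2 (rquot e M)).
  rewrite /rhess; under eq_bigr do under eq_bigr do rewrite mxE.
  under eq_bigr do rewrite -big_distrr/=.
  rewrite -big_distrr/=; congr (_ * _).
  under eq_bigr do rewrite big_split/= sumrN -!big_distrr/=.
  rewrite big_split/= sumrN -big_distrr/= -big_distrl/=; congr (_ * _ - _).
  by rewrite big_split/= sumrN sumr_const card_ord.
have t0 : 0 <= \tr (rinv e M) by apply: sumr_ge0 => i _; exact: rinv_diag_ge0.
have rq : frob2 (rquot e M) <= \tr (rinv e M).
  by rewrite mxtrace_rinv// lerDl mulr_ge0 ?frob2_ge0// ltW.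
rewrite mulNr mulNr oppr_le0 !mulr_ge0 ?(ltW s0) ?(ltW (rprior_gt0 _ _ e0))//.
rewrite subr_ge0 mxtrace_rquot//.
have h0 : 0 <= e * \tr (rinv e M) ^+ 2 by rewrite mulr_ge0 ?sqr_ge0// ltW.
have := @ler_wpM2l _ (2 * s + 1) _ _ _ rq; have := ler_wpM2r t0 snp.
have : 0 <= 2 * s + 1 by rewrite addr_ge0// mulr_ge0// ltW.
by move=> h1 h2 /(_ h1) h3; nra.
Qed.

(** Euler's relation for degree [- 2 s p]; the regularization weakens it to an inequality because
    the hat matrix has trace at most [p]. *)
Lemma inner_rgrad_ge e M : 0 < e ->
  - (2 * s * p%:R) * rprior e M <= inner M (rgrad e M).
Proof.
move=> e0.
have -> : inner M (rgrad e M) = - (2 * s) * rprior e M * \tr (rquot e M *m M^T).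
  rewrite /inner /mxtrace big_distrr/=; apply: eq_bigr => a _.
  by rewrite mxE big_distrr/=; apply: eq_bigr => i _; rewrite !mxE; ring.
have h : \tr (rquot e M *m M^T) <= p%:R.
  rewrite mxtrace_rquot// gerBl mulr_ge0 ?(ltW e0)//.
  by apply: sumr_ge0 => i _; exact: rinv_diag_ge0.
have k : 0 <= 2 * s * rprior e M by rewrite !mulr_ge0 ?(ltW s0) ?(ltW (rprior_gt0 _ _ e0)).
have := ler_wpM2l k h; nra.
Qed.

(* The entries of the inverse are bounded by [e^-1], so its determinant is at most [p`! e^-p]. *)
Lemma det_rgram_ge e : 0 < e -> exists2 c : R, 0 < c & forall M, c <= \det (rgram e M).
Proof.
move=> e0; pose K : R := #|{: 'S_p}|%:R * (e^-1) ^+ p.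
have K0 : 0 < K.
  rewrite mulr_gt0 ?exprn_gt0 ?invr_gt0// ltr0n; apply/card_gt0P.
  by exists 1%g.
exists K^-1; rewrite ?invr_gt0// => M.
rewrite -[leRHS]invrK lef_pV2 ?posrE ?invr_gt0 ?det_rgram_gt0//.
rewrite -det_inv -/(rinv e M); apply: (le_trans (ler_norm _)).
apply: (le_trans (ler_norm_sum _ _ _)).
rewrite /K mulr_natl -sumr_const; apply: ler_sum => /= t _.
rewrite normrM normrX normrN normr1 expr1n mul1r normr_prod.
rewrite -[X in _ ^+ X](card_ord p) -prodr_const.
by apply: ler_prod => i _; rewrite normr_ge0 rinv_le.
Qed.

Lemma le_powRN (a b : R) : 0 < a -> a <= b -> b `^ (- s) <= a `^ (- s).
Proof.
move=> a0 ab; have b0 := lt_le_trans a0 ab.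
rewrite !powRN lef_pV2 ?posrE ?powR_gt0//.
by apply: ge0_ler_powR; rewrite ?nnegrE ?(ltW s0) ?(ltW a0) ?(ltW b0).
Qed.

(** Uniformity in [M] supplies the growth conditions of Stein's identity. The bound may degenerate
    as [e] tends to 0, so what passes to the limit is the integral inequalities and not these
    estimates. *)
Lemma rprior_bounds e : 0 < e -> exists K : R, forall M a i,
  [/\ `|rprior e M| <= K, `|rgrad e M a i| <= K & `|rhess e M a i| <= K].
Proof.
move=> e0; have [c c0 hc] := det_rgram_ge e0.
pose K0 := c `^ (- s).
have hK M : rprior e M <= K0 by exact: le_powRN.
have K00 : 0 <= K0 by exact: powR_ge0.
have ie : 0 <= e^-1 by rewrite invr_ge0 ltW.
pose K1 := 2 * s * K0 * (1 + e^-1).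
pose K2 := 2 * s * K0 * ((1 + p%:R) * e^-1 + (2 * s + 1) * e^-1).
have K10 : 0 <= K1 by rewrite !mulr_ge0 ?addr_ge0// ltW.
have K20 : 0 <= K2 by rewrite !mulr_ge0 ?addr_ge0 ?mulr_ge0 ?addr_ge0 ?mulr_ge0// ltW.
exists (K0 + K1 + K2) => M a i.
have P0 := ltW (rprior_gt0 s M e0).
have s2 : 0 <= 2 * s by rewrite mulr_ge0// ltW.
split.
- by rewrite ger0_norm// (le_trans (hK M))// -addrA lerDl addr_ge0.
- rewrite mxE !normrM normrN (ger0_norm P0) (ger0_norm s2).
  apply: (@le_trans _ _ K1); last by rewrite addrAC lerDr addr_ge0.
  rewrite /K1 ler_pM ?mulr_ge0 ?(ltW s0)//.
    by rewrite ler_wpM2l// hK.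
  have := rquot_le M a i e0; have := sqr_ge0 (1 - `|rquot e M a i|).
  rewrite -(real_normK (num_real (rquot e M a i))); have := normr_ge0 (rquot e M a i); nra.
- rewrite mxE !normrM normrN (ger0_norm P0) (ger0_norm s2).
  apply: (@le_trans _ _ K2); last by rewrite lerDr addr_ge0.
  rewrite /K2 ler_pM ?mulr_ge0 ?(ltW s0)//.
    by rewrite ler_wpM2l// hK.
  apply: (le_trans (ler_normB _ _)); apply: lerD.
    rewrite normrM ler_pM// ?rinv_le//.
    by rewrite (le_trans (ler_normB _ _))// normr1 lerD2l ger0_norm ?rhat_diag_ge0// rhat_diag_le.
  rewrite normrM ger0_norm ?addr_ge0// ler_wpM2l ?addr_ge0//.
  by rewrite ger0_norm ?sqr_ge0// rquot_le.
Qed.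

Lemma le_rprior e1 e2 M : 0 < e1 -> e1 <= e2 -> rprior e2 M <= rprior e1 M.
Proof.
by move=> e10 e12; apply: le_powRN (le_det_rgram _ (ltW e10) e12); exact: det_rgram_gt0.
Qed.

Lemma rprior_le0 e M : 0 < \det (M^T *m M) -> 0 < e -> rprior e M <= rprior 0 M.
Proof.
by move=> d0 e0; apply: le_powRN (le_det_rgram _ (lexx 0) (ltW e0)); rewrite rgram0.
Qed.

Lemma cvg_det_rgram M : \det (rgram (j.+1%:R^-1) M) @[j --> \oo] --> \det (M^T *m M).
Proof.
have c := @continuous_det_line R _ (M^T *m M) 1%:M 0.
have := @cvg_comp _ _ _ (fun j : nat => j.+1%:R^-1 : R) _ _ _ _ (@cvg_harmonic R) c.
rewrite scale0r addr0; apply: cvg_trans.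
by apply: near_eq_cvg; near=> j; rewrite rgram_line.
Unshelve. all: by end_near. Qed.

Lemma cvg_rprior M : 0 < \det (M^T *m M) ->
  rprior (j.+1%:R^-1) M @[j --> \oo] --> rprior 0 M.
Proof.
move=> d0.
have c : {for \det (M^T *m M), continuous (fun x : R => x `^ (- s))}.
  apply: differentiable_continuous; apply/derivable1_diffP.
  by have [] := is_derive1_powR (- s) d0.
have -> : rprior 0 M = \det (M^T *m M) `^ (- s) by rewrite -rgram0.
exact: (continuous_cvg _ c (@cvg_det_rgram M)).
Qed.

Lemma rprior_unbounded M (K : R) : \det (M^T *m M) = 0 ->
  exists j : nat, K < rprior (j.+1%:R^-1) M.
Proof.
(* The value of the determinant at which the prior equals the absolute value of [K] plus 1. *)
move=> d0; pose c := (`|K| + 1) `^ (- s^-1).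
have K1 : 0 < `|K| + 1 by rewrite ltr_wpDl.
have c0 : 0 < c by rewrite powR_gt0.
have := @cvg_det_rgram M; rewrite d0 => /cvgrPdist_lt/(_ _ c0)[j _ /(_ j (leqnn j))].
rewrite sub0r normrN => hj; exists j.
have e0 : 0 < j.+1%:R^-1 :> R by rewrite invr_gt0.
rewrite ger0_norm in hj; last exact: ltW (det_rgram_gt0 M e0).
apply: (@lt_le_trans _ _ (`|K| + 1)); first by rewrite (le_lt_trans (ler_norm K))// ltrDl.
have -> : `|K| + 1 = c `^ (- s).
  by rewrite /c -powRrM mulrNN mulVf ?gt_eqF// powRr1// ltW.
by apply: le_powRN (ltW hj); exact: det_rgram_gt0.
Qed.

End PriorDerivatives.

(** * Integration over matrices *)

Section MatrixIntegral.
Context {R : realType}.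
Variables (n p : nat).
Implicit Types (M E Y : 'M[R]_(n, p)) (F G : 'M[R]_(n, p) -> R).
Notation lam := (@lebT R (n * p)).

Lemma tmxE (t : (n * p).-tuple R) a i : tmx t a i = tnth t (mxvec_index a i).
Proof. by rewrite /tmx !mxE. Qed.

Lemma tmx_translate X (t : (n * p).-tuple R) :
  tmx (tadd [tuple mxvec X 0 k | k < n * p] t) = tmx t + X.
Proof.
by apply/matrixP => a i; rewrite [RHS]mxE !tmxE !tnth_mktuple mxvecE.
Qed.

Lemma frob2_tmx (t : (n * p).-tuple R) : frob2 (tmx t) = \sum_(k < n * p) tnth t k ^+ 2.
Proof.
rewrite /frob2 pair_bigA /=.
rewrite [RHS](reindex _ (curry_mxvec_bij n p)).
by apply: eq_bigr => -[a i] _ /=; rewrite tmxE.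
Qed.

Definition mmeas (F : 'M[R]_(n, p) -> R) :=
  measurable_fun [set: (n * p).-tuple R] (fun t => F (tmx t)).

Lemma mmeas_entry a i : mmeas (fun M => M a i).
Proof.
rewrite /mmeas; under eq_fun do rewrite tmxE; exact: measurable_tnth.
Qed.

Lemma mmeas_cst (c : R) : mmeas (fun=> c).
Proof. exact: measurable_cst. Qed.

Lemma mmeasD F G : mmeas F -> mmeas G -> mmeas (fun M => F M + G M).
Proof. exact: measurable_funD. Qed.

Lemma mmeasB F G : mmeas F -> mmeas G -> mmeas (fun M => F M - G M).
Proof. exact: measurable_funB. Qed.

Lemma mmeasM F G : mmeas F -> mmeas G -> mmeas (fun M => F M * G M).
Proof. exact: measurable_funM. Qed.

Lemma mmeasX F k : mmeas F -> mmeas (fun M => F M ^+ k).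
Proof. exact: measurable_funX. Qed.

Lemma mmeas_comp (f : R -> R) F :
  measurable_fun setT f -> mmeas F -> mmeas (fun M => f (F M)).
Proof. by move=> mf mF; apply: measurableT_comp. Qed.

Lemma mmeasN F : mmeas F -> mmeas (fun M => - F M).
Proof. by move=> mF; exact: (mmeas_comp (@oppr_measurable R setT) mF). Qed.

Lemma mmeas_expR F : mmeas F -> mmeas (fun M => expR (F M)).
Proof. by move=> mF; exact: (mmeas_comp (@measurable_expR R) mF). Qed.

Lemma mmeas_sum (I : Type) (r : seq I) (P : pred I) (F : I -> 'M[R]_(n, p) -> R) :
  (forall i, mmeas (F i)) -> mmeas (fun M => \sum_(i <- r | P i) F i M).
Proof.
move=> mF; rewrite /mmeas; under eq_fun do rewrite big_mkcond.
elim: r => [|i r IH]; first by (under eq_fun do rewrite big_nil); exact: measurable_cst.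
under eq_fun do rewrite big_cons; apply: measurable_funD => //.
by case: (P i); [exact: mF|exact: measurable_cst].
Qed.

Lemma mmeas_prod (I : Type) (r : seq I) (F : I -> 'M[R]_(n, p) -> R) :
  (forall i, mmeas (F i)) -> mmeas (fun M => \prod_(i <- r) F i M).
Proof.
move=> mF; rewrite /mmeas.
elim: r => [|i r IH]; first by (under eq_fun do rewrite big_nil); exact: measurable_cst.
by under eq_fun do rewrite big_cons; apply: measurable_funM; [exact: mF|exact: IH].
Qed.

Lemma mmeas_det (k : nat) (A : 'M[R]_(n, p) -> 'M[R]_k) :
  (forall i j, mmeas (fun M => A M i j)) -> mmeas (fun M => \det (A M)).
Proof.
move=> mA; apply: mmeas_sum => s; apply: mmeasM; first exact: mmeas_cst.
by apply: mmeas_prod => i; exact: mA.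
Qed.

Lemma mmeas_frob2 Y : mmeas (fun M => frob2 (M - Y)).
Proof.
rewrite /frob2; apply: mmeas_sum => a; apply: mmeas_sum => i; apply: mmeasX.
rewrite /mmeas; under eq_fun do rewrite mxE.
by apply: measurable_funD; [exact: mmeas_entry|exact: measurable_cst].
Qed.

Definition mintegrable F := lam.-integrable [set: (n * p).-tuple R] (EFin \o (F \o @tmx R n p)).

(** An infinite integral is sent to 0, so [mint] is informative only together with [mintegrable];
    many lemmas below therefore deliver both. *)
Definition mint F : R := \int[lam]_t F (tmx t).

Lemma mint_EFin F : mintegrable F -> (\int[lam]_t (F (tmx t))%:E = (mint F)%:E)%E.
Proof.
move=> iF; rewrite /mint /Rintegral fineK//; exact: integrable_fin_num iF.
Qed.

Lemma mint_ge0 F : (forall M, 0 <= F M) -> 0 <= mint F.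
Proof. by move=> F0; apply: Rintegral_ge0. Qed.

Lemma mintegrable_meas F : mintegrable F -> mmeas F.
Proof. by move=> /integrableP[/measurable_EFinP]. Qed.

Lemma le_mintegrable F G : mmeas F -> (forall M, `|F M| <= G M) ->
  mintegrable G -> mintegrable F.
Proof.
move=> mF FG; apply: le_integrable => //; first exact/measurable_EFinP.
by move=> t _ /=; rewrite lee_fin (le_trans (FG _))// ler_norm.
Qed.

Lemma mintegrableD F G : mintegrable F -> mintegrable G -> mintegrable (fun M => F M + G M).
Proof. by move=> iF iG; exact: (integrableD measurableT iF iG). Qed.

Lemma mintegrableZ (c : R) F : mintegrable F -> mintegrable (fun M => c * F M).
Proof. by move=> iF; exact: (integrableZl measurableT c iF). Qed.

Lemma mintegrable_sum (I : Type) (r : seq I) (F : I -> 'M[R]_(n, p) -> R) :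
  (forall i, mintegrable (F i)) -> mintegrable (fun M => \sum_(i <- r) F i M).
Proof.
move=> iF; elim: r => [|i r IH].
  rewrite /mintegrable /comp; under eq_fun do rewrite big_nil.
  exact: integrable0.
rewrite /mintegrable /comp; under eq_fun do rewrite big_cons.
exact: (mintegrableD (iF i) IH).
Qed.

Lemma mintD F G : mintegrable F -> mintegrable G ->
  mint (fun M => F M + G M) = mint F + mint G.
Proof. by move=> iF iG; apply: RintegralD. Qed.

Lemma mintZ (c : R) F : mintegrable F -> mint (fun M => c * F M) = c * mint F.
Proof. by move=> iF; apply: RintegralZl. Qed.

Lemma mint_sum (I : Type) (r : seq I) (F : I -> 'M[R]_(n, p) -> R) :
  (forall i, mintegrable (F i)) ->
  mint (fun M => \sum_(i <- r) F i M) = \sum_(i <- r) mint (F i).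
Proof.
move=> iF; elim: r => [|i r IH].
  rewrite big_nil /mint; under eq_Rintegral do rewrite big_nil.
  by rewrite /Rintegral integral0.
rewrite big_cons -IH -mintD//; last exact: mintegrable_sum.
by apply: eq_Rintegral => t _; rewrite big_cons.
Qed.

Lemma le_mint F G : mintegrable F -> mintegrable G -> (forall M, F M <= G M) ->
  mint F <= mint G.
Proof. by move=> iF iG FG; apply: le_Rintegral. Qed.

Lemma mmeas_translate X F : mmeas F -> mmeas (fun M => F (M + X)).
Proof.
move=> mF; rewrite /mmeas; under eq_fun do rewrite -tmx_translate.
by apply: (measurableT_comp mF); exact: measurable_tadd.
Qed.

Lemma mint_translate X F : mmeas F -> mint (fun M => F (M + X)) = mint F.
Proof.
move=> mF; rewrite /mint /Rintegral; congr fine.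
under eq_integral do rewrite -tmx_translate.
rewrite (@integral_lebT_translate R _ _ (fun t => (F (tmx t))%:E))//.
exact/measurable_EFinP.
Qed.

Lemma mintegrable_translate X F : mintegrable F -> mintegrable (fun M => F (M + X)).
Proof.
move=> iF; have mF := mintegrable_meas iF; have /integrableP[_ lF] := iF.
apply/integrableP; split; first by apply/measurable_EFinP; exact: (mmeas_translate X mF).
under eq_integral do rewrite /= -tmx_translate.
rewrite (@ge0_integral_lebT_translate R _ _ (fun t => `|(F (tmx t))%:E|%E)); first exact: lF.
  by apply: measurableT_comp => //; exact/measurable_EFinP.
by move=> t; exact: abse_ge0.
Qed.

Lemma mintegrable_gauss (c : R) Y : 0 < c ->
  mintegrable (fun M => expR (- (c * frob2 (M - Y)))).
Proof.
move=> c0.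
suff H : mintegrable (fun M => expR (- (c * frob2 M))).
  exact: (mintegrable_translate (- Y) H).
apply/integrableP; split.
  apply/measurable_EFinP.
  have h : mmeas (@frob2 R n p).
    by have := mmeas_frob2 0; rewrite /mmeas; under eq_fun do rewrite subr0.
  exact: (mmeas_expR (mmeasN (mmeasM (mmeas_cst c) h))).
under eq_integral do rewrite /= ger0_norm ?expR_ge0// frob2_tmx.
exact: integrable_gaussT.
Qed.

Lemma frob2_scale (m k : nat) (x : R) (A : 'M[R]_(m, k)) :
  frob2 (x *: A) = x ^+ 2 * frob2 A.
Proof.
rewrite /frob2 big_distrr/=; apply: eq_bigr => a _; rewrite big_distrr/=.
by apply: eq_bigr => i _; rewrite mxE exprMn.
Qed.

(** Entrywise the difference of the two sides is half the square of [A + 2 B]. It lets a Gaussian of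
    half the rate dominate all small translates of a Gaussian. *)
Lemma frob2_add_ge (m k : nat) (A B : 'M[R]_(m, k)) :
  2^-1 * frob2 A - frob2 B <= frob2 (A + B).
Proof.
rewrite /frob2 big_distrr/= -sumrB; apply: ler_sum => a _.
rewrite big_distrr/= -sumrB; apply: ler_sum => i _; rewrite mxE.
have := sqr_ge0 (A a i + 2 * B a i); nra.
Qed.

Lemma mint_derive_eq0 (F dF : 'M[R]_(n, p) -> R) E Y (c C : R) :
  0 < c -> mmeas F ->
  (forall M (x : R), is_derive x 1 (fun h => F (M + h *: E)) (dF (M + x *: E))) ->
  (forall M, `|F M| <= C * expR (- (c * frob2 (M - Y)))) ->
  (forall M, `|dF M| <= C * expR (- (c * frob2 (M - Y)))) ->
  mint dF = 0.
Proof.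
move=> c0 mF hF bF bdF.
have iF : mintegrable F.
  by apply: (le_mintegrable mF bF); apply: mintegrableZ; exact: mintegrable_gauss.
pose f (x : R) (t : (n * p).-tuple R) := F (tmx t + x *: E).
(* By [frob2_add_ge], this dominates the derivative at every translate by [x *: E] with [x] between
   -1 and 1; [expR (c * frob2 E)] pays for the shift. *)
pose G (t : (n * p).-tuple R) := C * expR (c * frob2 E) * expR (- (c / 2 * frob2 (tmx t - Y))).
have I0 : `]-1, 1[%classic (0 : R) by rewrite /= in_itv/= ltrN10 ltr01.
have d1 x t : partial1of2 f x t = dF (tmx t + x *: E).
  by rewrite /partial1of2 derive1E; have [_ ->] := hF (tmx t) x.
have C0 : 0 <= C.
  have := bF Y; rewrite subrr (_ : frob2 0 = 0) ?mulr0 ?oppr0 ?expR0 ?mulr1.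
    exact: le_trans.
  by rewrite /frob2 big1// => a _; rewrite big1// => i _; rewrite mxE expr0n.
have H1 x : `]-1, 1[%classic x -> lam.-integrable setT (EFin \o f x).
  by move=> _; exact: (mintegrable_translate (x *: E) iF).
have H2 x t : `]-1, 1[%classic x -> setT t -> derivable (f^~ t) x 1.
  by move=> _ _; have [] := hF (tmx t) x.
have H3 t : 0 <= G t by rewrite !mulr_ge0 ?expR_ge0.
have H4 : lam.-integrable setT (EFin \o G).
  by apply: (@mintegrableZ _ (fun M => expR (- (c / 2 * frob2 (M - Y))))); exact: mintegrable_gauss (divr_gt0 c0 _).
have H5 x t : `]-1, 1[%classic x -> setT t -> `|partial1of2 f x t| <= G t.
  rewrite /= in_itv/= => /andP[x1 x2] _; rewrite d1 (le_trans (bdF _))// /G -mulrA ler_wpM2l//.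
  rewrite -expRD ler_expR.
  have := frob2_add_ge (tmx t - Y) (x *: E); rewrite frob2_scale addrAC => h.
  have x21 : x ^+ 2 <= 1 by rewrite expr2; nra.
  have : x ^+ 2 * frob2 E <= frob2 E by rewrite ler_piMl ?frob2_ge0.
  nra.
have := @differentiation_under_integral R _ _ lam f setT measurableT 0 (-1) 1 I0 H1 H2 G H3 H4 H5.
have -> : (fun x => \int[lam]_t f x t) = cst (mint F).
  by apply/funext => x; exact: (mint_translate (x *: E) mF).
rewrite derive1_cst => H; rewrite [RHS]H; apply: eq_Rintegral => t _.
by rewrite d1 scale0r addr0.
Qed.

End MatrixIntegral.

(** * Stein's identity *)

Section Stein.
Context {R : realType}.
Variables (n p : nat).
Implicit Types (M E Y : 'M[R]_(n, p)) (F G : 'M[R]_(n, p) -> R).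

Lemma frob2N (m k : nat) (A : 'M[R]_(m, k)) : frob2 (- A) = frob2 A.
Proof. by rewrite -scaleN1r frob2_scale sqrrN expr1n mul1r. Qed.

Lemma gdens_norm_gt0 : 0 < (2 * pi) `^ (- ((n * p)%:R / 2)) :> R.
Proof. by apply: powR_gt0; rewrite mulr_gt0// pi_gt0. Qed.

Lemma gdens_gt0 Y M : 0 < gdens Y M.
Proof. by rewrite /gdens mulr_gt0 ?expR_gt0 ?gdens_norm_gt0. Qed.

Lemma gdens_ge0 Y M : 0 <= gdens Y M.
Proof. exact: ltW (gdens_gt0 _ _). Qed.

Lemma gdensC Y M : gdens Y M = gdens M Y.
Proof. by rewrite /gdens -(frob2N (Y - M)) opprB. Qed.

Lemma gdens_translate Y M X : gdens (Y + X) (M + X) = gdens Y M.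
Proof. by rewrite /gdens opprD addrACA subrr addr0. Qed.

Lemma mmeas_gdens Y : mmeas (gdens Y).
Proof.
have h := mmeas_frob2 Y.
rewrite (_ : gdens Y = fun M => (2 * pi) `^ (- ((n * p)%:R / 2)) *
    expR (- (frob2 (M - Y) * 2^-1))); last first.
  by apply/funext => M; rewrite gdensC.
exact: (mmeasM (mmeas_cst _) (mmeas_expR (mmeasN (mmeasM h (mmeas_cst _))))).
Qed.

Lemma is_derive_frob2 (A E : 'M[R]_(n, p)) (x : R) :
  is_derive x 1 (fun h => frob2 (A + h *: E)) (2 * inner (A + x *: E) E).
Proof.
have hl := mx_derive_line x A E.
rewrite /frob2 /inner big_distrr/=.
apply: is_derive_bigsum => a _; rewrite big_distrr/=; apply: is_derive_bigsum => i _.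
have H := is_derive_mul (hl a i) (hl a i).
by apply: (is_derive_eq H); ring.
Qed.

Lemma is_derive_gdens Y M E (x : R) :
  is_derive x 1 (fun h => gdens Y (M + h *: E))
    (- inner (M + x *: E - Y) E * gdens Y (M + x *: E)).
Proof.
have h1 := is_derive_mull (- 2^-1) (is_derive_frob2 (M - Y) E x).
have h2 := is_derive_mull ((2 * pi) `^ (- ((n * p)%:R / 2)))
  (is_derive1_comp (is_derive_expR _) h1).
rewrite (_ : (fun h => gdens Y (M + h *: E)) = (fun h => (2 * pi) `^ (- ((n * p)%:R / 2)) *
  (expR \o (fun h => - 2^-1 * frob2 (M - Y + h *: E))) h)); last first.
  by apply/funext => h /=; rewrite gdensC /gdens addrAC mulNr [frob2 _ / 2]mulrC.
apply: (is_derive_eq h2); rewrite gdensC /gdens addrAC mulNr [frob2 _ / 2]mulrC.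
by field.
Qed.

Lemma normr_le_expR (x : R) : `|x| <= 8 * expR (x ^+ 2 / 8).
Proof.
have h := expR_ge1Dx (x ^+ 2 / 8).
have h1 := sqr_ge0 (`|x| - 1); have h2 := real_normK (num_real x); have h3 := normr_ge0 x.
nra.
Qed.

Lemma entry_le_expR M a i : `|M a i| <= 8 * expR (frob2 M / 8).
Proof.
rewrite (le_trans (normr_le_expR _))// ler_pM2l// ler_expR ler_pM2r ?invr_gt0//.
exact: sqr_le_frob2.
Qed.

(** The density decays at rate [1 / 2], so growth at rate [1 / 4] leaves an integrable Gaussian.
    Stein's identity multiplies a function by a coordinate, and each factor is allotted the rate
    [1 / 8]. *)
Lemma mintegrable_gdens F Y (C : R) : mmeas F ->
  (forall M, `|F M| <= C * expR (frob2 (M - Y) / 4)) ->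
  mintegrable (fun M => F M * gdens Y M).
Proof.
move=> mF bF.
pose k0 : R := (2 * pi) `^ (- ((n * p)%:R / 2)).
apply: (@le_mintegrable _ _ _ _ (fun M => k0 * C * expR (- (4^-1 * frob2 (M - Y))))).
- exact: mmeasM mF (mmeas_gdens Y).
- move=> M; rewrite normrM (ger0_norm (gdens_ge0 _ _)) gdensC /gdens -/k0.
  rewrite mulrCA -mulrA ler_pM2l ?gdens_norm_gt0//.
  apply: le_trans (ler_wpM2r (expR_ge0 _) (bF M)) _.
  rewrite -mulrA -expRD le_eqVlt; apply/orP; left; apply/eqP.
  by congr (_ * expR _); field.
- apply: mintegrableZ; apply: mintegrable_gauss; by rewrite invr_gt0.
Qed.

(** The vanishing integral of a derivative, [mint_derive_eq0], is applied to [G * gdens Y], whose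
    derivative along [delta_mx a i] is [(dG - (M - Y) a i * G) * gdens Y]. Each of the two terms is
    bounded with the constant [8 * C], hence [16 * C] in the proof. *)
Lemma mint_stein (G dG : 'M[R]_(n, p) -> R) Y a i (C : R) :
  mmeas G -> mmeas dG ->
  (forall M (x : R), is_derive x 1 (fun h => G (M + h *: delta_mx a i))
     (dG (M + x *: delta_mx a i))) ->
  (forall M, `|G M| <= C * expR (frob2 (M - Y) / 8)) ->
  (forall M, `|dG M| <= C * expR (frob2 (M - Y) / 8)) ->
  [/\ mintegrable (fun M => dG M * gdens Y M),
      mintegrable (fun M => (M - Y) a i * G M * gdens Y M) &
      mint (fun M => dG M * gdens Y M) = mint (fun M => (M - Y) a i * G M * gdens Y M)].
Proof.
move=> mG mdG hG bG bdG.
have C0 : 0 <= C.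
  by have := le_trans (normr_ge0 _) (bG Y); rewrite pmulr_lge0 ?expR_gt0.
have e48 M : expR (frob2 (M - Y) / 8) <= expR (frob2 (M - Y) / 4).
  by rewrite ler_expR ler_wpM2l ?frob2_ge0// lef_pV2 ?posrE// ler_nat.
have bdG4 M : `|dG M| <= 8 * C * expR (frob2 (M - Y) / 4).
  rewrite (le_trans (bdG M))// -mulrA; have := ler_wpM2l C0 (e48 M).
  have := mulr_ge0 C0 (expR_ge0 (frob2 (M - Y) / 4)); nra.
have bxG M : `|(M - Y) a i * G M| <= 8 * C * expR (frob2 (M - Y) / 4).
  rewrite normrM; apply: (le_trans (ler_pM _ _ (entry_le_expR _ _ _) (bG M))) => //.
  rewrite mulrACA -expRD le_eqVlt; apply/orP; left; apply/eqP.
  by congr (_ * expR _); field.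
have mx : mmeas (fun M => (M - Y) a i).
  rewrite /mmeas; under eq_fun do rewrite mxE.
  by apply: measurable_funD; [exact: mmeas_entry|exact: measurable_cst].
have i1 := mintegrable_gdens mdG bdG4.
have i2 := mintegrable_gdens (mmeasM mx mG) bxG.
split=> //; apply/eqP; rewrite -subr_eq0 -[X in _ - X]mul1r -mulNr -mintZ// -mintD//; last first.
  exact: mintegrableZ.
apply/eqP.
pose k0 : R := (2 * pi) `^ (- ((n * p)%:R / 2)).
have kb (F : 'M[R]_(n, p) -> R) (D : R) :
    (forall M, `|F M| <= D * expR (frob2 (M - Y) / 4)) ->
    forall M, `|F M * gdens Y M| <= k0 * D * expR (- (4^-1 * frob2 (M - Y))).
  move=> bF M; rewrite normrM (ger0_norm (gdens_ge0 _ _)) gdensC /gdens -/k0.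
  rewrite mulrCA -mulrA ler_pM2l ?gdens_norm_gt0//.
  apply: le_trans (ler_wpM2r (expR_ge0 _) (bF M)) _.
  rewrite -mulrA -expRD le_eqVlt; apply/orP; left; apply/eqP.
  by congr (_ * expR _); field.
apply: (@mint_derive_eq0 _ _ _ (fun M => G M * gdens Y M) _ (delta_mx a i) Y 4^-1 (k0 * (16 * C))).
- by rewrite invr_gt0.
- exact: mmeasM mG (mmeas_gdens Y).
- move=> M x; have H := is_derive_mul (hG M x) (is_derive_gdens Y M (delta_mx a i) x).
  by apply: (is_derive_eq H); rewrite inner_delta; ring.
- apply: kb => M; rewrite (le_trans (bG M))// -mulrA; have := ler_wpM2l C0 (e48 M).
  have := mulr_ge0 C0 (expR_ge0 (frob2 (M - Y) / 4)); nra.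
- move=> M; rewrite (_ : _ + _ = (dG M - (M - Y) a i * G M) * gdens Y M); last by ring.
  move: M; apply: kb => M; apply: (le_trans (ler_normB _ _)).
  by apply: (le_trans (lerD (bdG4 M) (bxG M))); lra.
Qed.

End Stein.

(** * Posterior moments for the regularized prior *)

Section RegularizedPosterior.
Context {R : realType}.
Variables (n p : nat) (s : R).
Hypothesis s0 : 0 < s.
Hypothesis snp : 2 * s + 1 <= n%:R - p%:R.
Implicit Types (M E Y : 'M[R]_(n, p)).
Notation rprior := (@rprior R n p s).
Notation rgrad := (@rgrad R n p s).
Notation rhess := (@rhess R n p s).

Lemma mmeas_gram (e : R) i j : mmeas (fun M => rgram e M i j).
Proof.
rewrite /mmeas /rgram; under eq_fun do rewrite mxE [X in X + _]mxE.
apply: measurable_funD; last exact: measurable_cst.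
apply: (@mmeas_sum _ n p _ _ _ (fun k M => M^T i k * M k j)) => k.
apply: mmeasM; last exact: mmeas_entry.
by rewrite /mmeas; under eq_fun do rewrite mxE; exact: mmeas_entry.
Qed.

Lemma mmeas_rprior (e : R) : mmeas (rprior e).
Proof.
apply: (mmeas_comp (@measurable_powR R (- s))).
by apply: mmeas_det => i j; exact: mmeas_gram.
Qed.

Section fixed_e.
Variable e : R.
Hypothesis e0 : 0 < e.

Lemma mmeas_rinv i j : mmeas (fun M => rinv e M i j).
Proof.
(* The determinant is positive, so its inverse is a real power, and [measurable_powR] applies. *)
rewrite (_ : (fun _ => _) = fun M => (\det (rgram e M)) `^ (-1) * cofactor (rgram e M) j i).
  apply: mmeasM.
    apply: (mmeas_comp (@measurable_powR R (-1))).
    by apply: mmeas_det => k l; exact: mmeas_gram.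
  apply: mmeasM; first exact: mmeas_cst.
  apply: mmeas_det => k l.
  rewrite (_ : (fun M => _) = fun M => rgram e M (lift j k) (lift i l)); first exact: mmeas_gram.
  by apply/funext => M; rewrite [LHS]mxE [LHS]mxE.
apply/funext => M; rewrite powR_inv1 ?(ltW (det_rgram_gt0 _ e0))//.
by rewrite /rinv /invmx rgram_unit// !mxE.
Qed.

Lemma mmeas_rquot a i : mmeas (fun M => rquot e M a i).
Proof.
rewrite /mmeas /rquot; under eq_fun do rewrite mxE.
apply: (@mmeas_sum _ n p _ _ _ (fun k M => M a k * rinv e M k i)) => k.
by apply: mmeasM; [exact: mmeas_entry|exact: mmeas_rinv].
Qed.

Lemma mmeas_rgrad a i : mmeas (fun M => rgrad e M a i).
Proof.
rewrite (_ : (fun _ => _) = fun M => - (2 * s) * rprior e M * rquot e M a i).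
  apply: mmeasM; last exact: mmeas_rquot.
  by apply: mmeasM; [exact: mmeas_cst|exact: mmeas_rprior].
by apply/funext => M; rewrite /rgrad mxE.
Qed.

Lemma mmeas_rhess a i : mmeas (fun M => rhess e M a i).
Proof.
rewrite (_ : (fun _ => _) = fun M => - (2 * s) * rprior e M *
  ((1 - \sum_k rquot e M a k * M a k) * rinv e M i i - (2 * s + 1) * rquot e M a i ^+ 2)).
  apply: mmeasM.
    by apply: mmeasM; [exact: mmeas_cst|exact: mmeas_rprior].
  apply: mmeasB; apply: mmeasM.
  - apply: mmeasB; first exact: mmeas_cst.
    by apply: mmeas_sum => k; apply: mmeasM; [exact: mmeas_rquot|exact: mmeas_entry].
  - exact: mmeas_rinv.
  - exact: mmeas_cst.
  - by apply: mmeasX; exact: mmeas_rquot.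
apply/funext => M; rewrite /rhess mxE; congr (_ * ((1 - _) * _ - _)).
by rewrite mxE; apply: eq_bigr => k _; rewrite [M^T _ _]mxE.
Qed.

Lemma expR_frob2_ge1 M (c : R) : 0 <= c -> 1 <= expR (frob2 M * c).
Proof. by move=> c0; rewrite -[leLHS]expR0 ler_expR mulr_ge0// frob2_ge0. Qed.

Lemma le_expR_frob2 (x K : R) M : `|x| <= K -> `|x| <= K * expR (frob2 M / 8).
Proof.
move=> xK; rewrite (le_trans xK)// ler_peMr ?expR_frob2_ge1 ?invr_ge0//.
exact: le_trans (normr_ge0 _) xK.
Qed.

Lemma stein_rprior Y a i :
  [/\ mintegrable (fun M => rgrad e M a i * gdens Y M),
      mintegrable (fun M => (M - Y) a i * rprior e M * gdens Y M) &
      mint (fun M => rgrad e M a i * gdens Y M) =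
      mint (fun M => (M - Y) a i * rprior e M * gdens Y M)].
Proof.
have [K hK] := @rprior_bounds R n p s s0 e e0.
apply: (mint_stein (C := K)).
- exact: mmeas_rprior.
- exact: mmeas_rgrad.
- by move=> M x; exact: is_derive_rprior_delta.
- by move=> M; apply: le_expR_frob2; have [] := hK M a i.
- by move=> M; apply: le_expR_frob2; have [] := hK M a i.
Qed.

Lemma stein_rgrad Y a i :
  [/\ mintegrable (fun M => rhess e M a i * gdens Y M),
      mintegrable (fun M => (M - Y) a i * rgrad e M a i * gdens Y M) &
      mint (fun M => rhess e M a i * gdens Y M) =
      mint (fun M => (M - Y) a i * rgrad e M a i * gdens Y M)].
Proof.
have [K hK] := @rprior_bounds R n p s s0 e e0.
apply: (mint_stein (C := K)).
- exact: mmeas_rgrad.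
- exact: mmeas_rhess.
- by move=> M x; exact: is_derive_rgrad_delta.
- by move=> M; apply: le_expR_frob2; have [] := hK M a i.
- by move=> M; apply: le_expR_frob2; have [] := hK M a i.
Qed.

Lemma mmeas_shift Y a i : mmeas (fun M => (M - Y) a i).
Proof.
rewrite /mmeas; under eq_fun do rewrite mxE.
by apply: measurable_funD; [exact: mmeas_entry|exact: measurable_cst].
Qed.

Lemma stein_shift_rprior Y a i :
  [/\ mintegrable (fun M => (rprior e M + (M - Y) a i * rgrad e M a i) * gdens Y M),
      mintegrable (fun M => (M - Y) a i * ((M - Y) a i * rprior e M) * gdens Y M) &
      mint (fun M => (rprior e M + (M - Y) a i * rgrad e M a i) * gdens Y M) =
      mint (fun M => (M - Y) a i * ((M - Y) a i * rprior e M) * gdens Y M)].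
Proof.
have [K hK] := @rprior_bounds R n p s s0 e e0.
have K0 M : 0 <= K by have [/(le_trans (normr_ge0 _))] := hK M a i.
have hs M (x : R) : `|x| <= K -> `|(M - Y) a i * x| <= 8 * K * expR (frob2 (M - Y) / 8).
  move=> xK; rewrite normrM mulrAC ler_pM//; exact: entry_le_expR.
(* The derivative is the prior, bounded by [K], plus a coordinate times the gradient, bounded by
   [8 * K] up to the exponential. *)
apply: (mint_stein (C := 9 * K)).
- by apply: mmeasM; [exact: mmeas_shift|exact: mmeas_rprior].
- apply: mmeasD; first exact: mmeas_rprior.
  by apply: mmeasM; [exact: mmeas_shift|exact: mmeas_rgrad].
- move=> M x.
  have h1 := is_derive_mul (mx_derive_line x (M - Y) (delta_mx a i) a i)
    (is_derive_rprior_delta s M a i x e0).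
  rewrite (_ : (fun h => (M + h *: delta_mx a i - Y) a i * rprior e (M + h *: delta_mx a i)) =
    (fun h => (M - Y + h *: delta_mx a i) a i * rprior e (M + h *: delta_mx a i))); last first.
    by apply/funext => h; rewrite addrAC.
  apply: (is_derive_eq h1); rewrite [X in X * _ + _]mxE !eqxx mul1r.
  by congr (_ + _ * _); rewrite addrAC.
- move=> M; have [h _ _] := hK M a i; apply: le_trans (hs M _ h) _.
  by rewrite ler_wpM2r ?expR_ge0// ler_wpM2r ?K0// ler_nat.
- move=> M; have [h1 h2 _] := hK M a i; apply: le_trans (ler_normD _ _) _.
  apply: le_trans (lerD (le_expR_frob2 (M - Y) h1) (hs M _ h2)) _.
  by rewrite le_eqVlt; apply/orP; left; apply/eqP; ring.
Qed.

Definition rmarg Y := mint (fun M => rprior e M * gdens Y M).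

Lemma mintegrable_rprior Y : mintegrable (fun M => rprior e M * gdens Y M).
Proof.
have [c c0 hc] := det_rgram_ge n p e0.
apply: (@mintegrable_gdens _ _ _ _ _ (c `^ (- s))); first exact: mmeas_rprior.
move=> M; rewrite ger0_norm ?(ltW (rprior_gt0 _ _ e0))//.
apply: (@le_trans _ _ (c `^ (- s))); first exact: le_powRN.
by rewrite ler_peMr ?powR_ge0// expR_frob2_ge1// invr_ge0.
Qed.

Lemma mint_sum2 (F : 'I_n -> 'I_p -> 'M[R]_(n, p) -> R) :
  (forall a i, mintegrable (F a i)) ->
  mintegrable (fun M => \sum_a \sum_i F a i M) /\
  mint (fun M => \sum_a \sum_i F a i M) = \sum_a \sum_i mint (F a i).
Proof.
move=> iF; split.
  by apply: mintegrable_sum => a; apply: mintegrable_sum => i.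
rewrite mint_sum; last by move=> a; apply: mintegrable_sum => i.
by apply: eq_bigr => a _; rewrite mint_sum.
Qed.

Lemma sum_mint_rhess Y : \sum_a \sum_i mint (fun M => rhess e M a i * gdens Y M) <= 0.
Proof.
have iF a i : mintegrable (fun M => rhess e M a i * gdens Y M) by have [] := stein_rgrad Y a i.
have [ih <-] := mint_sum2 iF.
rewrite -oppr_ge0 -mulN1r -mintZ//; apply: mint_ge0 => M.
rewrite mulN1r oppr_ge0.
under eq_bigr do rewrite -mulr_suml; rewrite -mulr_suml.
by rewrite mulr_le0_ge0 ?gdens_ge0// sum_rhess_le0.
Qed.

(** Two integrations by parts turn each coordinate of the second moment into the marginal plus the
    integral of a pure second derivative. Over the [n * p] coordinates the latter add up to the
    integral of the Laplacian, which is nonpositive. *)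
Lemma rmarg_second_moment Y :
  mintegrable (fun M => frob2 (M - Y) * (rprior e M * gdens Y M)) /\
  mint (fun M => frob2 (M - Y) * (rprior e M * gdens Y M)) <= (n * p)%:R * rmarg Y.
Proof.
have E : (fun M => frob2 (M - Y) * (rprior e M * gdens Y M)) =
  (fun M => \sum_a \sum_i (M - Y) a i * ((M - Y) a i * rprior e M) * gdens Y M).
  apply/funext => M; rewrite /frob2 mulr_suml; apply: eq_bigr => a _.
  by rewrite mulr_suml; apply: eq_bigr => i _; ring.
have iF a i : mintegrable (fun M => (M - Y) a i * ((M - Y) a i * rprior e M) * gdens Y M).
  by have [] := stein_shift_rprior Y a i.
have [i1 E1] := mint_sum2 iF; rewrite E; split=> //; rewrite E1.
have E2 a i : mint (fun M => (M - Y) a i * ((M - Y) a i * rprior e M) * gdens Y M) =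
    rmarg Y + mint (fun M => rhess e M a i * gdens Y M).
  have [_ _ <-] := stein_shift_rprior Y a i; have [_ i2 ->] := stein_rgrad Y a i.
  rewrite /rmarg -mintD//; last exact: mintegrable_rprior.
  by apply: eq_Rintegral => t _; ring.
under eq_bigr do under eq_bigr do rewrite E2.
under eq_bigr do rewrite big_split/= sumr_const card_ord.
rewrite big_split/= sumr_const card_ord -mulrnA mulnC mulr_natl.
by rewrite gerDl sum_mint_rhess.
Qed.

(** The integral of [Y.grad pi] is at least its sum with the integral of [(M - Y).grad pi], since
    the latter equals the integral of the Laplacian. The two integrands add up to [M.grad pi], to
    which [inner_rgrad_ge] applies pointwise. *)
Lemma rmarg_inner Y :
  mintegrable (fun M => inner Y (M - Y) * (rprior e M * gdens Y M)) /\
  - (2 * s * p%:R) * rmarg Y <= mint (fun M => inner Y (M - Y) * (rprior e M * gdens Y M)).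
Proof.
have E : (fun M => inner Y (M - Y) * (rprior e M * gdens Y M)) =
  (fun M => \sum_a \sum_i Y a i * ((M - Y) a i * rprior e M * gdens Y M)).
  apply/funext => M; rewrite /inner mulr_suml; apply: eq_bigr => a _.
  by rewrite mulr_suml; apply: eq_bigr => i _; ring.
have i0 a i : mintegrable (fun M => (M - Y) a i * rprior e M * gdens Y M).
  by have [] := stein_rprior Y a i.
have i1 a i : mintegrable (fun M => (M - Y) a i * rgrad e M a i * gdens Y M).
  by have [] := stein_rgrad Y a i.
have i2 a i : mintegrable (fun M => rgrad e M a i * gdens Y M).
  by have [] := stein_rprior Y a i.
have iF a i : mintegrable (fun M => Y a i * ((M - Y) a i * rprior e M * gdens Y M)).
  exact: mintegrableZ.
have i3 a i : mintegrable (fun M => Y a i * (rgrad e M a i * gdens Y M)).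
  exact: mintegrableZ.
have [j1 E1] := mint_sum2 iF; rewrite E; split=> //; rewrite E1.
have [j2 E2] := mint_sum2 i3; have [j3 E3] := mint_sum2 i1.
have -> : \sum_a \sum_i mint (fun M => Y a i * ((M - Y) a i * rprior e M * gdens Y M)) =
    mint (fun M => \sum_a \sum_i Y a i * (rgrad e M a i * gdens Y M)).
  rewrite E2; apply: eq_bigr => a _; apply: eq_bigr => i _.
  by rewrite mintZ// mintZ//; have [_ _ ->] := stein_rprior Y a i.
have h : mint (fun M => \sum_a \sum_i (M - Y) a i * rgrad e M a i * gdens Y M) <= 0.
  rewrite E3; apply: le_trans (sum_mint_rhess Y); rewrite le_eqVlt; apply/orP; left; apply/eqP.
  by apply: eq_bigr => a _; apply: eq_bigr => i _; have [_ _ ->] := stein_rgrad Y a i.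
apply: (@le_trans _ _ (mint (fun M => \sum_a \sum_i Y a i * (rgrad e M a i * gdens Y M)) +
  mint (fun M => \sum_a \sum_i (M - Y) a i * rgrad e M a i * gdens Y M))).
  rewrite /rmarg -mintZ; last exact: mintegrable_rprior.
  rewrite -mintD//; apply: le_mint.
  - by apply: mintegrableZ; exact: mintegrable_rprior.
  - exact: mintegrableD.
  - move=> M; rewrite mulrA.
    have -> : \sum_a \sum_i Y a i * (rgrad e M a i * gdens Y M) +
        \sum_a \sum_i (M - Y) a i * rgrad e M a i * gdens Y M =
        inner M (rgrad e M) * gdens Y M.
      rewrite -big_split/= /inner mulr_suml; apply: eq_bigr => a _.
      rewrite -big_split/= mulr_suml; apply: eq_bigr => i _; rewrite [(M - Y) a i]mxE [(- Y) a i]mxE.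
      by ring.
    by rewrite ler_wpM2r ?gdens_ge0// inner_rgrad_ge.
by rewrite gerDl.
Qed.

Lemma mintegrable_bounded_gdens (F : 'M[R]_(n, p) -> R) Y (K : R) : mmeas F ->
  (forall M, `|F M| <= K) -> mintegrable (fun M => F M * gdens Y M).
Proof.
move=> mF bF; apply: (@mintegrable_gdens _ _ _ _ _ K) => // M.
rewrite (le_trans (bF M))// ler_peMr ?expR_frob2_ge1 ?invr_ge0//.
exact: le_trans (normr_ge0 _) (bF M).
Qed.

End fixed_e.
End RegularizedPosterior.

(** * Mean value inequality for the Gaussian-smoothed prior *)

Section MarginalBound.
Context {R : realType}.
Variables (n p : nat).
Implicit Types (M E Y Z : 'M[R]_(n, p)).
Notation lam := (@lebT R (n * p)).

Lemma mmeas_affine Y (u : R) (F : 'M[R]_(n, p) -> R) :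
  mmeas F -> mmeas (fun M => F (Y + u *: M)).
Proof.
move=> mF; pose g (t : (n * p).-tuple R) : (n * p).-tuple R :=
  [tuple u * tnth t k | k < n * p].
have mg : measurable_fun [set: (n * p).-tuple R] g.
  apply/measurable_fun_tnthP => k.
  rewrite (_ : _ \o _ = fun t => u * tnth t k); last first.
    by apply/funext => t /=; rewrite tnth_mktuple.
  by apply: measurable_funM => //; exact: measurable_tnth.
rewrite /mmeas (_ : (fun t => _) = (fun t => F (tmx t + Y)) \o g).
  apply: measurableT_comp mg; exact: (mmeas_translate Y mF).
apply/funext => t /=; congr F; rewrite addrC; congr (_ + _).
by apply/matrixP => a i; rewrite [LHS]mxE !tmxE tnth_mktuple.
Qed.

Variables (s e : R).
Hypothesis s0 : 0 < s.
Hypothesis snp : 2 * s + 1 <= n%:R - p%:R.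
Hypothesis e0 : 0 < e.
Notation rprior := (@rprior R n p s e).
Notation rgrad := (@rgrad R n p s e).
Notation rhess := (@rhess R n p s e).

Lemma is_derive_rgrad_line Y Z a i (u x : R) :
  is_derive x 1 (fun h => rgrad (Y + u *: (Z + h *: delta_mx a i)) a i)
    (u * rhess (Y + u *: (Z + x *: delta_mx a i)) a i).
Proof.
have E h : Y + u *: (Z + h *: delta_mx a i) = (Y + u *: Z) + (u * h) *: delta_mx a i.
  by rewrite scalerDr scalerA addrA.
have h1 : is_derive x 1 (fun h => u * h) u.
  by have H := is_derive_mull u (is_derive_id x 1); apply: (is_derive_eq H); rewrite mulr1.
have h2 := is_derive_rgrad_delta s (Y + u *: Z) a i (u * x) e0.
have h3 := is_derive1_comp h2 h1.
rewrite (_ : (fun h => rgrad _ a i) =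
  (fun h => rgrad (Y + u *: Z + h *: delta_mx a i) a i) \o (fun h => u * h)); last first.
  by apply/funext => h /=; rewrite E.
by apply: (is_derive_eq h3); rewrite E mulrC.
Qed.

(** The prior smoothed by Gaussian noise of scale [u]. The scale sits inside the prior and not in
    the density, so [u = 0] is an ordinary point. *)
Let f Y (u : R) := mint (fun Z => rprior (Y + u *: Z) * gdens 0 Z).

Let K := projT1 (cid (@rprior_bounds R n p s s0 e e0)).

Let hK M a i : [/\ `|rprior M| <= K, `|rgrad M a i| <= K & `|rhess M a i| <= K].
Proof. by rewrite /K; case: cid => k /=; exact. Qed.

Lemma stein_rgrad_line Y (u : R) a i :
  [/\ mintegrable (fun Z => u * rhess (Y + u *: Z) a i * gdens 0 Z),
      mintegrable (fun Z => Z a i * rgrad (Y + u *: Z) a i * gdens 0 Z) &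
      mint (fun Z => u * rhess (Y + u *: Z) a i * gdens 0 Z) =
      mint (fun Z => Z a i * rgrad (Y + u *: Z) a i * gdens 0 Z)].
Proof.
have K0 : 0 <= K by have [/(le_trans (normr_ge0 _))] := hK 0 a i.
have C0 : 0 <= (1 + `|u|) * K by rewrite mulr_ge0// addr_ge0.
have h Z (x D : R) : `|x| <= D -> `|x| <= D * expR (frob2 (Z - 0) / 8).
  exact: le_expR_frob2.
have := @mint_stein R n p (fun Z => rgrad (Y + u *: Z) a i)
  (fun Z => u * rhess (Y + u *: Z) a i) 0 a i ((1 + `|u|) * K).
have E : (fun Z : 'M[R]_(n, p) => (Z - 0) a i * rgrad (Y + u *: Z) a i * gdens 0 Z) =
  (fun Z => Z a i * rgrad (Y + u *: Z) a i * gdens 0 Z).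
  by apply/funext => Z; rewrite subr0.
rewrite E; apply.
- by apply: (mmeas_affine Y u (F := fun M => rgrad M a i)); exact: mmeas_rgrad.
- apply: mmeasM; first exact: mmeas_cst.
  by apply: (mmeas_affine Y u (F := fun M => rhess M a i)); exact: mmeas_rhess.
- by move=> Z x; exact: is_derive_rgrad_line.
- move=> Z; apply: h; have [_ h1 _] := hK (Y + u *: Z) a i.
  by rewrite (le_trans h1)// mulrDl mul1r lerDl mulr_ge0.
- move=> Z; apply: h; have [_ _ h1] := hK (Y + u *: Z) a i.
  rewrite normrM mulrDl mul1r (le_trans (ler_wpM2l (normr_ge0 _) h1))//.
  by rewrite lerDr.
Qed.

Lemma mintegrable_abs_gdens a i :
  mintegrable (fun Z => `|Z a i| * gdens 0 Z).
Proof.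
apply: (@mintegrable_gdens _ _ _ _ _ 8).
  by apply: (mmeas_comp (@normr_measurable R setT)); exact: mmeas_entry.
move=> Z; rewrite normr_id subr0 (le_trans (entry_le_expR _ _ _))//.
by rewrite ler_pM2l// ler_expR ler_wpM2l ?frob2_ge0// lef_pV2 ?posrE// ler_nat.
Qed.

Lemma is_derive_smoothed Y (u : R) :
  is_derive u 1 (f Y) (mint (fun Z => inner (rgrad (Y + u *: Z)) Z * gdens 0 Z)).
Proof.
pose g (x : R) (t : (n * p).-tuple R) := rprior (Y + x *: tmx t) * gdens 0 (tmx t).
pose G (t : (n * p).-tuple R) := \sum_a \sum_i (K * (`|tmx t a i| * gdens 0 (tmx t))).
have I0 : `]u - 1, u + 1[%classic u by rewrite /= in_itv/= ltrBlDr ltrDl ltr01.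
have dg (x : R) t : is_derive x 1 (g ^~ t)
    (inner (rgrad (Y + x *: tmx t)) (tmx t) * gdens 0 (tmx t)).
  have h := is_derive_rprior s Y (tmx t) x e0.
  have H := is_derive_mul h (is_derive_cst (gdens 0 (tmx t)) x 1).
  apply: (is_derive_eq H); rewrite mulr0 addr0; congr (_ * _).
  rewrite /inner mulrA big_distrr/=; apply: eq_bigr => a _.
  by rewrite big_distrr/=; apply: eq_bigr => i _; rewrite [in RHS]mxE mulrA.
have d1 x t : partial1of2 g x t = inner (rgrad (Y + x *: tmx t)) (tmx t) * gdens 0 (tmx t).
  by rewrite /partial1of2 derive1E; have [_ ->] := dg x t.
have H1 x : `]u - 1, u + 1[%classic x -> lam.-integrable setT (EFin \o g x).
  move=> _; pose c := projT1 (cid2 (det_rgram_ge n p e0)).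
  apply: (@mintegrable_bounded_gdens R n p (fun Z => rprior (Y + x *: Z)) 0
    (projT1 (cid2 (det_rgram_ge n p e0)) `^ (- s))).
    by apply: (mmeas_affine Y x (F := rprior)); exact: mmeas_rprior.
  move=> Z; rewrite ger0_norm ?(ltW (rprior_gt0 _ _ e0))//.
  by case: cid2 => d d0 hd /=; exact: le_powRN.
have H2 x t : `]u - 1, u + 1[%classic x -> setT t -> derivable (g^~ t) x 1.
  by move=> _ _; have [] := dg x t.
have hb t (x : R) a i : `|rgrad (Y + x *: tmx t) a i * tmx t a i * gdens 0 (tmx t)| <=
    K * (`|tmx t a i| * gdens 0 (tmx t)).
  rewrite normrM (ger0_norm (gdens_ge0 _ _)) normrM -mulrA ler_wpM2r//.
    by rewrite mulr_ge0// gdens_ge0.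
  by have [] := hK (Y + x *: tmx t) a i.
have H3 t : 0 <= G t.
  do 2 (apply: sumr_ge0 => ? _); exact: le_trans (normr_ge0 _) (hb t 0 _ _).
have H4 : lam.-integrable setT (EFin \o G).
  apply: (@mintegrable_sum _ _ _ _ _ (fun a Z => \sum_i (K * (`|Z a i| * gdens 0 Z)))) => a.
  apply: mintegrable_sum => i; apply: mintegrableZ; exact: mintegrable_abs_gdens.
have H5 x t : `]u - 1, u + 1[%classic x -> setT t -> `|partial1of2 g x t| <= G t.
  move=> _ _; rewrite d1 /inner mulr_suml (le_trans (ler_norm_sum _ _ _))//.
  apply: ler_sum => a _; rewrite mulr_suml (le_trans (ler_norm_sum _ _ _))//.
  by apply: ler_sum => i _; exact: hb.
apply: DeriveDef.
  exact: (@derivable_under_integral R _ _ lam g setT measurableT u (u - 1) (u + 1) I0 H1 H2 G H3 H4 H5).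
rewrite -derive1E.
rewrite (@differentiation_under_integral R _ _ lam g setT measurableT u (u - 1) (u + 1) I0 H1 H2 G H3 H4 H5).
by apply: eq_Rintegral => t _; rewrite d1.
Qed.

(** The scale runs from 0, where the smoothed prior is the value at [Y] times the Gaussian mass, to
    1, where it is the marginal. Its derivative is the integral of [grad pi.Z], which integration by
    parts in [Z] turns into [u] times the integral of the Laplacian, so it is nonpositive. *)
Lemma rmarg_le Y : rmarg s e Y <= rprior Y * mint (gdens (0 : 'M[R]_(n, p))).
Proof.
have -> : rmarg s e Y = f Y 1.
  rewrite /rmarg /f -(mint_translate Y); last first.
    by apply: mmeasM; [exact: mmeas_rprior|exact: mmeas_gdens].
  apply: eq_Rintegral => t _; rewrite scale1r addrC.
  by rewrite -{2}(add0r Y) [Y + _]addrC gdens_translate.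
have <- : f Y 0 = rprior Y * mint (gdens (0 : 'M[R]_(n, p))).
  rewrite /f -mintZ.
    by apply: eq_Rintegral => t _; rewrite scale0r addr0.
  have := @mintegrable_bounded_gdens R n p (fun=> 1) 0 1 (mmeas_cst 1).
  rewrite normr1 => /(_ (fun=> lexx _)); rewrite /mintegrable /comp.
  by under eq_fun do rewrite mul1r.
apply: (@ler0_derive1_le_cc _ (f Y) 0 1) => //.
- by move=> x _; have [] := is_derive_smoothed Y x.
- move=> x; rewrite in_itv/= => /andP[x0 _]; rewrite derive1E.
  have [_ ->] := is_derive_smoothed Y x.
  have i1 a i : mintegrable (fun Z => Z a i * rgrad (Y + x *: Z) a i * gdens 0 Z).
    by have [] := stein_rgrad_line Y x a i.
  have i2 a i : mintegrable (fun Z => x * rhess (Y + x *: Z) a i * gdens 0 Z).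
    by have [] := stein_rgrad_line Y x a i.
  have -> : mint (fun Z => inner (rgrad (Y + x *: Z)) Z * gdens 0 Z) =
    mint (fun Z => \sum_a \sum_i x * rhess (Y + x *: Z) a i * gdens 0 Z).
    have [_ ->] := mint_sum2 i2.
    transitivity (mint (fun Z => \sum_a \sum_i Z a i * rgrad (Y + x *: Z) a i * gdens 0 Z)).
      apply: eq_Rintegral => t _; rewrite /inner mulr_suml; apply: eq_bigr => a _.
      by rewrite mulr_suml; apply: eq_bigr => i _; ring.
    have [_ ->] := mint_sum2 i1; apply: eq_bigr => a _; apply: eq_bigr => i _.
    by have [_ _ ->] := stein_rgrad_line Y x a i.
  have [j2 _] := mint_sum2 i2.
  rewrite -oppr_ge0 -mulN1r -mintZ//; apply: mint_ge0 => Z; rewrite mulN1r oppr_ge0.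
  under eq_bigr do rewrite -mulr_suml -big_distrr/=.
  rewrite -mulr_suml -big_distrr/= mulr_le0_ge0 ?gdens_ge0//.
  by rewrite mulr_ge0_le0 ?(ltW x0)// sum_rhess_le0.
- apply/continuous_subspaceT; apply: derivable_continuous => x; exact: is_derive_smoothed.
- by rewrite in_itv/= lexx ler01.
- by rewrite in_itv/= ler01 lexx.
Qed.

End MarginalBound.

(** * Removing the regularization *)

Section Limits.
Context {R : realType}.
Variables (n p : nat).
Implicit Types (M E Y Z : 'M[R]_(n, p)) (F G : 'M[R]_(n, p) -> R).
Notation lam := (@lebT R (n * p)).

(** Strict inequalities between integrals rest on this: over a null space every almost-everywhere
    statement would hold. *)
Lemma lebT_setT_neq0 k : @lebT R k [set: k.-tuple R] != 0%E.
Proof.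
elim: k => [|k IH].
  by rewrite -lebTE /= indicT oner_neq0.
rewrite lebT_consE cons_measureE.
rewrite (_ : (fun x => _) = cst (@lebT R k [set: k.-tuple R])); last first.
  by apply/funext => x /=; congr (lebT k _); apply/seteqP; split.
rewrite integral_cst// mule_eq0 negb_or IH/=.
by rewrite -set_itvNyy lebesgue_measure_itv.
Qed.

Lemma mint_gt0 F : mintegrable F -> (forall M, 0 <= F M) ->
  {ae lam, forall t, 0 < F (tmx t)} -> 0 < mint F.
Proof.
move=> iF F0 aF; rewrite lt_def mint_ge0// andbT; apply/eqP => h.
have mF : measurable_fun setT (fun t : (n * p).-tuple R => (F (tmx t))%:E).
  by apply/measurable_EFinP; exact: mintegrable_meas.
have : (\int[lam]_t `|(F (tmx t))%:E| = 0)%E.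
  under eq_integral do rewrite gee0_abs ?lee_fin//.
  by rewrite mint_EFin// h.
move/(ae_eq_integral_abs lam measurableT mF) => a0.
have : {ae lam, forall t : (n * p).-tuple R, False}.
  apply: filterS2 aF a0 => t /= Ft /(_ I) [] Ft0; move: Ft; by rewrite Ft0 ltxx.
case=> A [mA A0 TA].
have AT : A = setT by apply/seteqP; split => // t _; apply: TA.
by have := lebT_setT_neq0 (n * p); rewrite -AT A0 eqxx.
Qed.

Section monotone.
Variables (F_ : nat -> 'M[R]_(n, p) -> R) (c : R).
Hypothesis iF_ : forall j, mintegrable (F_ j).
Hypothesis F0 : forall j M, 0 <= F_ j M.
Hypothesis ndF : forall M i j, (i <= j)%N -> F_ i M <= F_ j M.
Hypothesis Fc : forall j, mint (F_ j) <= c.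

Let L (t : (n * p).-tuple R) : \bar R := limn (fun j => (F_ j (tmx t))%:E).

Let nd t : nondecreasing_seq (fun j => (F_ j (tmx t))%:E).
Proof. by move=> i j ij; rewrite lee_fin ndF. Qed.

Let mF_ j : measurable_fun setT (fun t : (n * p).-tuple R => (F_ j (tmx t))%:E).
Proof. by apply/measurable_EFinP; exact: mintegrable_meas. Qed.

Let leL j t : ((F_ j (tmx t))%:E <= L t)%E.
Proof.
have /cvg_lim h := ereal_nondecreasing_cvgn (nd t).
by rewrite /L h//; apply: ereal_sup_ubound; exists j.
Qed.

Let iL : lam.-integrable setT L.
Proof.
have mL : measurable_fun setT L.
  apply: (emeasurable_fun_cvg (fun j t => (F_ j (tmx t))%:E)) => // t _.
  exact: ereal_nondecreasing_is_cvgn (nd t).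
have L0 t : (0 <= L t)%E by apply: le_trans (leL 0 t); rewrite lee_fin.
apply/integrableP; split => //; apply: (@le_lt_trans _ _ c%:E); last exact: ltry.
under eq_integral do rewrite gee0_abs//.
have F0' j t : setT t -> (0 <= (F_ j (tmx t))%:E)%E by rewrite lee_fin.
rewrite (monotone_convergence lam measurableT mF_ F0' (fun t _ => nd t)).
apply: lime_le.
  apply: ereal_nondecreasing_is_cvgn => i j ij.
  by rewrite !mint_EFin// lee_fin; apply: le_mint => // M; exact: ndF.
by apply: nearW => j /=; rewrite mint_EFin// lee_fin.
Qed.

(** Beppo Levi's argument: the extended-real limit [L] has integral at most [c], hence is finite
    almost everywhere. No limit function is presupposed, so the lemma can itself show where the
    regularized priors stay bounded. *)
Lemma mint_monotone_bounded :
  {ae lam, forall t, exists r, forall j, F_ j (tmx t) <= r}.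
Proof.
have := integrable_ae measurableT iL; apply: filterS => t /(_ I) fL.
by exists (fine (L t)) => j; rewrite -lee_fin fineK.
Qed.

(** The limit [L] serves as the dominating function, so that convergence to [F] is required only
    almost everywhere. *)
Lemma mint_monotone_limit F : mmeas F ->
  {ae lam, forall t, F_ j (tmx t) @[j --> \oo] --> F (tmx t)} ->
  mintegrable F /\ mint F <= c.
Proof.
move=> mF aF.
have mF' : measurable_fun setT (fun t : (n * p).-tuple R => (F (tmx t))%:E).
  exact/measurable_EFinP.
have cF : {ae lam, forall t, setT t -> (F_ j (tmx t))%:E @[j --> \oo] --> (F (tmx t))%:E}.
  by apply: filterS aF => t h _; exact: cvg_EFin (nearW _ _) h.
have bF : {ae lam, forall t j, setT t -> (`|(F_ j (tmx t))%:E| <= L t)%E}.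
  by apply: aeW => t j _; rewrite gee0_abs ?lee_fin.
have [iF _ lF] := dominated_convergence measurableT mF_ mF' cF iL bF.
split => //; rewrite -lee_fin -mint_EFin//.
have <- := cvg_lim (@ereal_hausdorff _) lF.
apply: lime_le; first by apply/cvg_ex; eexists; exact: lF.
by apply: nearW => j /=; rewrite mint_EFin// lee_fin.
Qed.

End monotone.

Lemma mint_dominated_ge0 (F_ : nat -> 'M[R]_(n, p) -> R) F G :
  (forall j, mintegrable (F_ j)) -> mmeas F -> mintegrable G ->
  {ae lam, forall t, F_ j (tmx t) @[j --> \oo] --> F (tmx t)} ->
  {ae lam, forall t j, `|F_ j (tmx t)| <= G (tmx t)} ->
  (forall j, 0 <= mint (F_ j)) ->
  mintegrable F /\ 0 <= mint F.
Proof.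
move=> iF_ mF iG aF bG F0.
have mF' : measurable_fun setT (fun t : (n * p).-tuple R => (F (tmx t))%:E).
  exact/measurable_EFinP.
have mF_ j : measurable_fun setT (fun t : (n * p).-tuple R => (F_ j (tmx t))%:E).
  by apply/measurable_EFinP; exact: mintegrable_meas.
have cF : {ae lam, forall t, setT t -> (F_ j (tmx t))%:E @[j --> \oo] --> (F (tmx t))%:E}.
  by apply: filterS aF => t h _; exact: cvg_EFin (nearW _ _) h.
have bF : {ae lam, forall t j, setT t -> (`|(F_ j (tmx t))%:E| <= (G (tmx t))%:E)%E}.
  by apply: filterS bG => t h j _; rewrite lee_fin.
have [iF _ lF] := dominated_convergence measurableT mF_ mF' cF iG bF.
split => //; rewrite -lee_fin -mint_EFin//.
have <- := cvg_lim (@ereal_hausdorff _) lF.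
apply: lime_ge; first by apply/cvg_ex; eexists; exact: lF.
by apply: nearW => j /=; rewrite mint_EFin// lee_fin.
Qed.

End Limits.

(** * Posterior moments for the singular prior *)

Section SingularPosterior.
Context {R : realType}.
Variables (n p : nat) (s : R).
Hypothesis pn : (p <= n)%N.
Hypothesis s0 : 0 < s.
Hypothesis snp : 2 * s + 1 <= n%:R - p%:R.
Implicit Types (M E Y Z : 'M[R]_(n, p)).
Notation lam := (@lebT R (n * p)).
Notation rprior := (@rprior R n p s).
Notation ej := (fun j : nat => j.+1%:R^-1 : R).

Let ej0 j : 0 < ej j. Proof. by rewrite invr_gt0. Qed.

Let ndej M i j : (i <= j)%N -> rprior (ej i) M <= rprior (ej j) M.
Proof. by move=> ij; apply: le_rprior => //; rewrite lef_pV2 ?posrE// ler_nat. Qed.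

Let c0 := mint (gdens (0 : 'M[R]_(n, p))).

Let c00 : 0 <= c0. Proof. by apply: mint_ge0 => M; exact: gdens_ge0. Qed.

Let marg_le Y j : 0 < \det (Y^T *m Y) -> rmarg s (ej j) Y <= rprior 0 Y * c0.
Proof.
move=> Y0; apply: le_trans (rmarg_le s0 snp (ej0 j) Y) _.
by apply: ler_wpM2r c00 _ _ _; exact: rprior_le0.
Qed.

Let w_ Y j M := rprior (ej j) M * gdens Y M.

Let iw_ Y j : mintegrable (w_ Y j).
Proof. exact: (mintegrable_rprior s0 (ej0 j) Y). Qed.

Let w_0 Y j M : 0 <= w_ Y j M.
Proof. by rewrite mulr_ge0 ?gdens_ge0// ltW// rprior_gt0. Qed.

Let ndw_ Y M i j : (i <= j)%N -> w_ Y i M <= w_ Y j M.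
Proof. by move=> ij; apply: ler_wpM2r (gdens_ge0 _ _) _ _ _; exact: ndej. Qed.

(* The regularized priors blow up on the rank-deficient matrices whereas their
   marginals at a full-rank matrix stay bounded. *)
Lemma ae_full_rank : {ae lam, forall t, 0 < \det ((tmx t : 'M[R]_(n, p))^T *m tmx t)}.
Proof.
(* One full-rank observation is enough; as [p <= n], the Gram matrix of this one is the identity. *)
pose Y : 'M[R]_(n, p) := pid_mx p.
have Y0 : 0 < \det (Y^T *m Y).
  rewrite /Y tr_pid_mx mul_pid_mx minnn (minn_idPr pn) pid_mx_1 det1; exact: ltr01.
have := mint_monotone_bounded (iw_ Y) (w_0 Y) (ndw_ Y) (fun j => marg_le j Y0).
apply: filterS => t [r hr]; rewrite lt_def det_gram_ge0 andbT; apply/eqP => d0.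
have [j] := rprior_unbounded s0 (r / gdens Y (tmx t)) d0.
by rewrite ltr_pdivrMr ?gdens_gt0// ltNge hr.
Qed.

Variable Y : 'M[R]_(n, p).
Hypothesis Y0 : 0 < \det (Y^T *m Y).

Let w M := rprior 0 M * gdens Y M.

Let mw : mmeas w.
Proof. by apply: mmeasM; [exact: mmeas_rprior|exact: mmeas_gdens]. Qed.

Let cw : {ae lam, forall t, w_ Y j (tmx t) @[j --> \oo] --> w (tmx t)}.
Proof.
by apply: filterS ae_full_rank => t d0; apply: cvgMl; exact: cvg_rprior.
Qed.

Lemma posterior_integrable : mintegrable w.
Proof.
by have [] := mint_monotone_limit (iw_ Y) (w_0 Y) (ndw_ Y) (fun j => marg_le j Y0) mw cw.
Qed.

Let w0 M : 0 <= w M.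
Proof. by rewrite mulr_ge0 ?gdens_ge0// powR_ge0. Qed.

Let w_w : {ae lam, forall t j, w_ Y j (tmx t) <= w (tmx t)}.
Proof.
apply: filterS ae_full_rank => t d0 j.
by apply: ler_wpM2r (gdens_ge0 _ _) _ _ _; exact: rprior_le0.
Qed.

Lemma posterior_marginal_gt0 : 0 < mint w.
Proof.
apply: mint_gt0 posterior_integrable w0 _.
apply: filterS ae_full_rank => t d0.
by rewrite mulr_gt0 ?gdens_gt0// powR_gt0// rgram0.
Qed.

Lemma ae_le_mint (F G : 'M[R]_(n, p) -> R) : mintegrable F -> mintegrable G ->
  (forall M, 0 <= F M) -> (forall M, 0 <= G M) ->
  {ae lam, forall t, F (tmx t) <= G (tmx t)} -> mint F <= mint G.
Proof.
move=> iF iG F0 G0 FG; rewrite -lee_fin -!mint_EFin//.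
apply: ae_ge0_le_integral => //.
- by move=> t _; rewrite lee_fin.
- by apply/measurable_EFinP; exact: mintegrable_meas.
- by move=> t _; rewrite lee_fin.
- by apply/measurable_EFinP; exact: mintegrable_meas.
by apply: filterS FG => t h _; rewrite lee_fin.
Qed.

(** The integrands are nonnegative and increase as [e] decreases, so monotone convergence applies;
    each regularized marginal is at most [mint w]. *)
Lemma posterior_second_moment :
  mintegrable (fun M => frob2 (M - Y) * w M) /\
  mint (fun M => frob2 (M - Y) * w M) <= (n * p)%:R * mint w.
Proof.
apply: (@mint_monotone_limit _ _ _ (fun j M => frob2 (M - Y) * w_ Y j M)).
- by move=> j; have [] := rmarg_second_moment s0 snp (ej0 j) Y.
- by move=> j M; rewrite mulr_ge0 ?frob2_ge0.
- by move=> M i j ij; apply: ler_wpM2l (frob2_ge0 _) _ _ _; exact: ndw_.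
- move=> j; have [_ h] := rmarg_second_moment s0 snp (ej0 j) Y.
  apply: le_trans h _; apply: ler_wpM2l (ler0n _ _) _ _ _.
  apply: ae_le_mint (iw_ Y j) posterior_integrable (w_0 Y j) w0 _.
  by apply: filterS w_w => t; exact.
- by apply: mmeasM; [exact: mmeas_frob2|exact: mw].
- by apply: filterS cw => t h; exact: cvgMr.
Qed.

Let inner_le M : `|inner Y (M - Y)| <= frob2 Y + frob2 (M - Y).
Proof.
rewrite /inner (le_trans (ler_norm_sum _ _ _))// /frob2 -big_split/=.
apply: ler_sum => a _; rewrite (le_trans (ler_norm_sum _ _ _))// -big_split/=.
apply: ler_sum => i _; rewrite normrM.
rewrite -(real_normK (num_real (Y a i))) -(real_normK (num_real ((M - Y) a i))).
have := sqr_ge0 (`|Y a i| - `|(M - Y) a i|).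
have := sqr_ge0 (`|Y a i|); have := sqr_ge0 (`|(M - Y) a i|); nra.
Qed.

Lemma mmeas_inner : mmeas (fun M => inner Y (M - Y)).
Proof.
rewrite /inner; apply: mmeas_sum => a; apply: mmeas_sum => i.
by apply: mmeasM; [exact: mmeas_cst|exact: mmeas_shift].
Qed.

(** The integrand has no sign, so the limit is by domination, with the second moment providing the
    dominating function. Adding [k * w] turns the lower bound into the nonnegativity of an integral,
    the form in which it passes to the limit. *)
Lemma posterior_inner :
  mintegrable (fun M => inner Y (M - Y) * w M) /\
  - (2 * s * p%:R) * mint w <= mint (fun M => inner Y (M - Y) * w M).
Proof.
pose k : R := 2 * s * p%:R.
have k0 : 0 <= k by rewrite !mulr_ge0// ltW.
have iwk : mintegrable (fun M => (frob2 Y + k) * w M + frob2 (M - Y) * w M).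
  apply: mintegrableD; first exact: mintegrableZ posterior_integrable.
  by have [] := posterior_second_moment.
have ii : mintegrable (fun M => inner Y (M - Y) * w M).
  apply: (le_mintegrable _ _ iwk).
    by apply: mmeasM; [exact: mmeas_inner|exact: mw].
  move=> M; rewrite normrM (ger0_norm (w0 M)) -mulrDl; apply: ler_wpM2r (w0 M) _ _ _.
  by rewrite (le_trans (inner_le M))// addrAC lerDl.
split=> //.
have : mintegrable (fun M => (inner Y (M - Y) + k) * w M) /\
    0 <= mint (fun M => (inner Y (M - Y) + k) * w M).
  apply: (@mint_dominated_ge0 _ _ _ (fun j M => (inner Y (M - Y) + k) * w_ Y j M) _
    (fun M => (frob2 Y + k) * w M + frob2 (M - Y) * w M)).
  - move=> j; rewrite (_ : (fun M => _) = fun M => inner Y (M - Y) * w_ Y j M + k * w_ Y j M).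
      apply: mintegrableD; last exact: mintegrableZ (iw_ Y j).
      by have [] := rmarg_inner s0 snp (ej0 j) Y.
    by apply/funext => M; rewrite mulrDl.
  - apply: mmeasM; last exact: mw.
    by apply: mmeasD; [exact: mmeas_inner|exact: mmeas_cst].
  - exact: iwk.
  - by apply: filterS cw => t h; exact: cvgMr.
  - apply: filterS w_w => t h j; rewrite normrM (ger0_norm (w_0 _ _ _)) -mulrDl.
    apply: ler_pM (normr_ge0 _) (w_0 _ _ _) _ (h j).
    by rewrite (le_trans (ler_normD _ _))// (ger0_norm k0) addrAC lerD2r inner_le.
  - move=> j; have [i1 h] := rmarg_inner s0 snp (ej0 j) Y.
    rewrite (_ : (fun M => _) = fun M => inner Y (M - Y) * w_ Y j M + k * w_ Y j M).
      rewrite mintD; [|exact: i1|exact: mintegrableZ (iw_ Y j)].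
      rewrite mintZ; last exact: iw_.
      by rewrite -lerBlDr sub0r -mulNr; exact: h.
    by apply/funext => M; rewrite mulrDl.
case=> _; rewrite (_ : (fun M => _) = fun M => inner Y (M - Y) * w M + k * w M); last first.
  by apply/funext => M; rewrite mulrDl.
rewrite mintD; [|exact: ii|exact: mintegrableZ posterior_integrable].
rewrite mintZ; last exact: posterior_integrable.
by rewrite -lerBlDr sub0r -mulNr; exact.
Qed.

End SingularPosterior.

(** * The generalized Bayes estimator *)

Section GeneralizedBayes.
Context {R : realType}.
Variables (n p : nat).
Hypothesis hnp : (p.+1 < n)%N.
Implicit Types (M E Y Z : 'M[R]_(n, p)).
Notation lam := (@lebT R (n * p)).
Let s : R := (n%:R - p%:R - 1) / 2.

Let s0 : 0 < s.
Proof.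
have : (p.+1%:R : R) < n%:R by rewrite ltr_nat.
rewrite -natr1 /s => h; rewrite divr_gt0//; lra.
Qed.

Let snp : 2 * s + 1 <= n%:R - p%:R :> R.
Proof. rewrite /s; lra. Qed.

Let pn : (p <= n)%N. Proof. by apply: ltnW; apply: ltnW. Qed.

Let pi_svsE M : pi_svs M = rprior s 0 M.
Proof. by rewrite /pi_svs /rprior rgram0. Qed.

Let w Y M := rprior s 0 M * gdens Y M.

Lemma ae_svs_full_rank : {ae lam, forall t, 0 < \det ((tmx t : 'M[R]_(n, p))^T *m tmx t)}.
Proof. exact: (ae_full_rank pn s0 snp). Qed.

Section full.
Variable Y : 'M[R]_(n, p).
Hypothesis Y0 : 0 < \det (Y^T *m Y).

Let iw : mintegrable (w Y).
Proof. exact: (posterior_integrable pn s0 snp Y0). Qed.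

Let m0 : 0 < mint (w Y).
Proof. exact: (posterior_marginal_gt0 pn s0 snp Y0). Qed.

Let w0 M : 0 <= w Y M.
Proof. by rewrite mulr_ge0 ?gdens_ge0// powR_ge0. Qed.

Let mw : mmeas (w Y). Proof. exact: mintegrable_meas. Qed.

Let ixx a i : mintegrable (fun M => (M - Y) a i ^+ 2 * w Y M).
Proof.
have [h _] := posterior_second_moment pn s0 snp Y0; apply: (le_mintegrable _ _ h).
  by apply: mmeasM; [apply: mmeasX; exact: mmeas_shift|exact: mw].
move=> M; rewrite ger0_norm; last exact: mulr_ge0 (sqr_ge0 _) (w0 M).
by apply: ler_wpM2r (w0 M) _ _ _; exact: sqr_le_frob2.
Qed.

Let ix a i : mintegrable (fun M => (M - Y) a i * w Y M).
Proof.
apply: (le_mintegrable _ _ (mintegrableD iw (ixx a i))).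
  by apply: mmeasM; [exact: mmeas_shift|exact: mw].
move=> M; rewrite normrM (ger0_norm (w0 M)) -[X in _ <= X + _]mul1r -mulrDl.
apply: ler_wpM2r (w0 M) _ _ _.
have := sqr_ge0 (`|(M - Y) a i| - 1); have := normr_ge0 ((M - Y) a i).
have := real_normK (num_real ((M - Y) a i)); nra.
Qed.

(** At a full-rank [Y] all the integrals in [gen_bayes] are finite and the marginal is positive, so
    neither [fine] nor the division produces a default value. *)
Lemma gen_bayes_shift a i :
  (gen_bayes (@pi_svs R n p) Y - Y) a i =
  mint (fun M => (M - Y) a i * w Y M) / mint (w Y).
Proof.
have -> : mint (fun M => (M - Y) a i * w Y M) =
    mint (fun M => M a i * w Y M) - Y a i * mint (w Y).
  have -> : (fun M => M a i * w Y M) = (fun M => (M - Y) a i * w Y M + Y a i * w Y M).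
    by apply/funext => M; rewrite [(M - Y) a i]mxE [(- Y) a i]mxE; ring.
  rewrite mintD//; last exact: mintegrableZ.
  by rewrite mintZ// addrK.
rewrite mulrBl mulfK ?gt_eqF// [LHS]mxE [(- Y) a i]mxE; congr (_ - _).
rewrite /gen_bayes mxE /marginal lebTE.
have -> : (\int[lam]_t (gdens Y (tmx t) * pi_svs (tmx t))%:E)%E = (mint (w Y))%:E.
  by rewrite -mint_EFin//; apply: eq_integral => t _; rewrite pi_svsE mulrC.
have -> : (\int[lam]_t (tmx t a i * gdens Y (tmx t) * pi_svs (tmx t))%:E)%E =
    (mint (fun M => M a i * w Y M))%:E.
  rewrite -mint_EFin; first by apply: eq_integral => t _; rewrite pi_svsE /w; congr EFin; ring.
  have -> : (fun M => M a i * w Y M) = (fun M => (M - Y) a i * w Y M + Y a i * w Y M).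
    by apply/funext => M; rewrite [(M - Y) a i]mxE [(- Y) a i]mxE; ring.
  by apply: mintegrableD => //; exact: mintegrableZ.
by [].
Qed.

Lemma gen_bayes_inner :
  - (p%:R * (n%:R - p%:R - 1)) <= inner Y (gen_bayes (@pi_svs R n p) Y - Y).
Proof.
have [ii h] := posterior_inner pn s0 snp Y0.
have -> : inner Y (gen_bayes (@pi_svs R n p) Y - Y) =
    mint (fun M => inner Y (M - Y) * w Y M) / mint (w Y).
  have i1 a i : mintegrable (fun M => Y a i * ((M - Y) a i * w Y M)) by exact: mintegrableZ.
  have -> : (fun M => inner Y (M - Y) * w Y M) =
      (fun M => \sum_a \sum_i Y a i * ((M - Y) a i * w Y M)).
    apply/funext => M; rewrite /inner mulr_suml; apply: eq_bigr => a _.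
    by rewrite mulr_suml; apply: eq_bigr => i _; rewrite mulrA.
  have [_ ->] := mint_sum2 i1; rewrite /inner mulr_suml; apply: eq_bigr => a _.
  rewrite mulr_suml; apply: eq_bigr => i _; rewrite gen_bayes_shift mintZ//.
  by rewrite mulrA.
rewrite ler_pdivlMr//; apply: le_trans h.
by rewrite le_eqVlt; apply/orP; left; apply/eqP; rewrite /s; congr (_ * _); field.
Qed.

(* Cauchy-Schwarz for the posterior, from [0 <= mint ((x - c)^2 w)] with [c] the
   posterior mean of [x]. *)
Lemma gen_bayes_dist : frob2 (gen_bayes (@pi_svs R n p) Y - Y) <= (n * p)%:R.
Proof.
have [h1 h2] := posterior_second_moment pn s0 snp Y0.
rewrite -(ler_pM2r m0); apply: le_trans h2.
have -> : (fun M => frob2 (M - Y) * (rprior s 0 M * gdens Y M)) =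
    (fun M => \sum_a \sum_i (M - Y) a i ^+ 2 * w Y M).
  apply/funext => M; rewrite /frob2 mulr_suml; apply: eq_bigr => a _.
  by rewrite mulr_suml.
have [_ ->] := mint_sum2 ixx.
rewrite /frob2 mulr_suml; apply: ler_sum => a _; rewrite mulr_suml; apply: ler_sum => i _.
rewrite gen_bayes_shift; set c := _ / _.
have cE : mint (fun M => (M - Y) a i * w Y M) = c * mint (w Y).
  by rewrite /c divfK// gt_eqF.
have : 0 <= mint (fun M => ((M - Y) a i - c) ^+ 2 * w Y M).
  by apply: mint_ge0 => M; exact: mulr_ge0 (sqr_ge0 _) (w0 M).
have -> : (fun M => ((M - Y) a i - c) ^+ 2 * w Y M) = (fun M => (M - Y) a i ^+ 2 * w Y M +
   ((- (2 * c)) * ((M - Y) a i * w Y M) + c ^+ 2 * w Y M)).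
  by apply/funext => M; ring.
rewrite mintD; [|exact: ixx|apply: mintegrableD; exact: mintegrableZ].
rewrite mintD; [|exact: mintegrableZ|exact: mintegrableZ].
by rewrite !mintZ// cE; lra.
Qed.

End full.

(** * Measurability of the estimator *)

(** Tonelli's theorem is applied to the positive and negative parts separately, since integrability
    is not assumed at any value of the parameter. *)
Lemma measurable_integral_param (F : 'M[R]_(n, p) -> 'M[R]_(n, p) -> R) :
  measurable_fun [set: ((n * p).-tuple R * (n * p).-tuple R)%type]
    (fun z => F (tmx z.1) (tmx z.2)) ->
  measurable_fun [set: (n * p).-tuple R]
    (fun y => fine (\int[lam]_t (F (tmx y) (tmx t))%:E)%E).
Proof.
move=> mF; apply: measurableT_comp; first exact: fine_measurable.
pose f (z : ((n * p).-tuple R * (n * p).-tuple R)%type) := (F (tmx z.1) (tmx z.2))%:E.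
have mf : measurable_fun [set: ((n * p).-tuple R * (n * p).-tuple R)%type] f.
  exact/measurable_EFinP.
under eq_fun do rewrite integralE.
apply: emeasurable_funB.
  have := @measurable_fun_fubini_tonelli_F _ _ _ _ R lam _ (measurable_funepos mf) (funepos_ge0 f).
  apply: eq_measurable_fun => y _; rewrite /fubini_F; apply: eq_integral => t _.
  by rewrite !funeposE.
have := @measurable_fun_fubini_tonelli_F _ _ _ _ R lam _ (measurable_funeneg mf) (funeneg_ge0 f).
apply: eq_measurable_fun => y _; rewrite /fubini_F; apply: eq_integral => t _.
by rewrite !funenegE.
Qed.

Lemma measurable_gdens2 :
  measurable_fun [set: ((n * p).-tuple R * (n * p).-tuple R)%type]
    (fun z => gdens (tmx z.1) (tmx z.2)).
Proof.
rewrite /gdens; apply: measurable_funM; first exact: measurable_cst.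
apply: measurableT_comp => //; apply: measurableT_comp => //.
apply: measurable_funM; last exact: measurable_cst.
rewrite /frob2; apply: measurable_sum => a; apply: measurable_sum => i.
apply: measurable_funX.
have E (x y : (n * p).-tuple R) : (tmx x - tmx y : 'M[R]_(n, p)) a i =
    tnth x (mxvec_index a i) - tnth y (mxvec_index a i).
  by rewrite -!tmxE [LHS]mxE; congr (_ + _); rewrite [LHS]mxE.
under eq_fun do rewrite E; apply: measurable_funB.
  exact: measurableT_comp (measurable_tnth _) measurable_fst.
exact: measurableT_comp (measurable_tnth _) measurable_snd.
Qed.

Lemma mmeas_gen_bayes a i : mmeas (fun Y => gen_bayes (@pi_svs R n p) Y a i).
Proof.
have mpi : mmeas (@pi_svs R n p).
  rewrite (_ : @pi_svs R n p = rprior s 0); first exact: mmeas_rprior.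
  by apply/funext => M; exact: pi_svsE.
have mpi2 : measurable_fun [set: ((n * p).-tuple R * (n * p).-tuple R)%type]
    (fun z => pi_svs (tmx z.2 : 'M[R]_(n, p))).
  exact: (measurableT_comp mpi measurable_snd).
have me2 : measurable_fun [set: ((n * p).-tuple R * (n * p).-tuple R)%type]
    (fun z => (tmx z.2 : 'M[R]_(n, p)) a i).
  exact: (measurableT_comp (mmeas_entry a i) measurable_snd).
rewrite /mmeas /gen_bayes; under eq_fun do rewrite mxE /marginal lebTE.
apply: measurable_funM.
  apply: (@measurable_integral_param (fun Y M => M a i * gdens Y M * pi_svs M)).
  by apply: measurable_funM => //; apply: measurable_funM => //; exact: measurable_gdens2.
rewrite (_ : (fun y => _) = (fun y => fine (\int[lam]_t (gdens (tmx y) (tmx t) *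
    pi_svs (tmx t : 'M[R]_(n, p)))%:E)%E `^ (- 1))); last first.
  apply/funext => y; rewrite powR_inv1//; apply: fine_ge0; apply: integral_ge0 => t _.
  by rewrite lee_fin mulr_ge0 ?gdens_ge0// powR_ge0.
apply: (measurableT_comp (@measurable_powR R (-1))).
apply: (@measurable_integral_param (fun Y M => gdens Y M * pi_svs M)).
by apply: measurable_funM => //; exact: measurable_gdens2.
Qed.

End GeneralizedBayes.

(** * Risk comparison *)

Section RiskComparison.
Context {R : realType}.
Variables (n p : nat).
Implicit Types (M E Y Z : 'M[R]_(n, p)).
Notation lam := (@lebT R (n * p)).

(** This and the next lemma allow pointwise comparisons of losses that are available only at
    observations of full rank. *)
Lemma ae_mint_ge0 (H : 'M[R]_(n, p) -> R) : mintegrable H ->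
  {ae lam, forall t, 0 <= H (tmx t)} -> 0 <= mint H.
Proof.
move=> iH aH.
have -> : mint H = mint (fun M => `|H M|); last by apply: mint_ge0.
rewrite /mint /Rintegral; congr fine; apply: ae_eq_integral => //.
- by apply/measurable_EFinP; exact: mintegrable_meas.
- apply/measurable_EFinP; apply: (measurableT_comp (@normr_measurable R setT)).
  exact: mintegrable_meas.
by apply: filterS aH => t h _; rewrite ger0_norm.
Qed.

Lemma ae_le_mintegrable (F G : 'M[R]_(n, p) -> R) : mmeas F ->
  (forall M, 0 <= F M) -> (forall M, 0 <= G M) -> mintegrable G ->
  {ae lam, forall t, F (tmx t) <= G (tmx t)} -> mintegrable F.
Proof.
move=> mF F0 G0 iG FG; apply/integrableP; split; first exact/measurable_EFinP.
apply: (@le_lt_trans _ _ (mint G)%:E); last exact: ltry.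
rewrite -mint_EFin//; under eq_integral do rewrite /= ger0_norm//.
apply: ae_ge0_le_integral => //.
- by move=> t _; rewrite lee_fin.
- exact/measurable_EFinP.
- by move=> t _; rewrite lee_fin.
- by apply/measurable_EFinP; exact: mintegrable_meas.
by apply: filterS FG => t h _; rewrite lee_fin.
Qed.

Let q Y : R := (1 + frob2 Y)^-1.

Let f1 Y : 0 < 1 + frob2 Y.
Proof. by rewrite ltr_pwDl ?frob2_ge0. Qed.

Let q0 Y : 0 < q Y. Proof. by rewrite invr_gt0. Qed.

Let q1 Y : q Y <= 1.
Proof. by rewrite invf_le1 ?f1// lerDl frob2_ge0. Qed.

Let fq Y : frob2 Y * q Y = 1 - q Y.
Proof. by rewrite -[X in X * _](addrK 1) mulrBl mul1r [_ + 1]addrC divff ?gt_eqF. Qed.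

Let mq : mmeas q.
Proof.
rewrite (_ : q = fun Y => (1 + frob2 (Y - 0)) `^ (-1)).
  apply: (mmeas_comp (@measurable_powR R (-1))); apply: mmeasD; first exact: mmeas_cst.
  exact: mmeas_frob2.
by apply/funext => Y; rewrite subr0 powR_inv1// ltW.
Qed.

Let abs_q Y a i : `|Y a i * q Y| <= 1.
Proof.
rewrite normrM (ger0_norm (ltW (q0 Y))).
have h : `|Y a i| <= 1 + Y a i ^+ 2.
  have := sqr_ge0 (`|Y a i| - 1); have := normr_ge0 (Y a i).
  have := real_normK (num_real (Y a i)); nra.
have := ler_wpM2r (ltW (q0 Y)) h; rewrite mulrDl mul1r => h1.
have h2 := ler_wpM2r (ltW (q0 Y)) (sqr_le_frob2 Y a i).
by rewrite fq in h2; lra.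
Qed.

(** The partial derivative of [Y a i * q Y] in its own coordinate, a summand of the divergence of
    [q Y *: Y]. *)
Let dq Y a i : R := q Y - 2 * (Y a i * q Y) ^+ 2.

Let is_derive_q Y a i (x : R) :
  is_derive x 1 (fun h => (Y + h *: delta_mx a i) a i * q (Y + h *: delta_mx a i))
    (dq (Y + x *: delta_mx a i) a i).
Proof.
have hf : is_derive x 1 (fun h => 1 + frob2 (Y + h *: delta_mx a i))
    (0 + 2 * inner (Y + x *: delta_mx a i) (delta_mx a i)).
  exact: (is_deriveD (is_derive_cst (1 : R) x 1) (is_derive_frob2 Y (delta_mx a i) x)).
have hn : 1 + frob2 (Y + x *: delta_mx a i) != 0 by rewrite gt_eqF.
have H := is_derive_mul (mx_derive_line x Y (delta_mx a i) a i) (@is_deriveV R (fun h => 1 + frob2 (Y + h *: delta_mx a i)) x _ 1 hn hf).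
apply: (is_derive_eq H); rewrite inner_delta add0r [delta_mx a i a i]mxE !eqxx mul1r.
rewrite -/(q (Y + x *: delta_mx a i)) /dq exprMn /GRing.scale/= -exprVn -/(q _).
by ring.
Qed.

Let mdq a i : mmeas (fun Y => dq Y a i).
Proof.
apply: mmeasB; first exact: mq.
apply: mmeasM; first exact: mmeas_cst.
by apply: mmeasX; apply: mmeasM; [exact: mmeas_entry|exact: mq].
Qed.

Let dq_le Y a i : `|dq Y a i| <= 3.
Proof.
have h1 : (Y a i * q Y) ^+ 2 <= 1.
  rewrite -(real_normK (num_real _)) -[leRHS](expr1n _ 2).
  by rewrite ler_pXn2r ?nnegrE.
have := sqr_ge0 (Y a i * q Y); have := q0 Y; have := q1 Y.
by rewrite /dq ler_norml => *; apply/andP; split; lra.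
Qed.

Lemma stein_q M a i :
  [/\ mintegrable (fun Y => dq Y a i * gdens M Y),
      mintegrable (fun Y => (Y - M) a i * (Y a i * q Y) * gdens M Y) &
      mint (fun Y => dq Y a i * gdens M Y) =
      mint (fun Y => (Y - M) a i * (Y a i * q Y) * gdens M Y)].
Proof.
apply: (@mint_stein _ _ _ (fun Y => Y a i * q Y) _ _ _ _ 3).
- by apply: mmeasM; [exact: mmeas_entry|exact: mq].
- exact: mdq.
- by move=> Y x; exact: is_derive_q.
- by move=> Y; apply: le_expR_frob2; apply: le_trans (abs_q Y a i) _; rewrite ler1n.
- by move=> Y; apply: le_expR_frob2.
Qed.

Let sum_dq Y : \sum_a \sum_i dq Y a i = (n * p)%:R * q Y - 2 * (frob2 Y * q Y ^+ 2).
Proof.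
rewrite /dq; under eq_bigr do rewrite big_split/= sumr_const card_ord sumrN -big_distrr/=.
rewrite big_split/= sumr_const card_ord sumrN -big_distrr/= -mulrnA mulnC [X in _ = X - _]mulr_natl.
congr (_ - _ * _); rewrite /frob2 mulr_suml; apply: eq_bigr => a _.
by rewrite mulr_suml; apply: eq_bigr => i _; rewrite exprMn.
Qed.

Hypothesis hnp : (p.+1 < n)%N.
Hypothesis hp : (2 <= p)%N.

Let k : R := p%:R * (n%:R - p%:R - 1).
Let gb := gen_bayes (@pi_svs R n p).
Let est Y : 'M[R]_(n, p) := gb Y - q Y *: Y.
(** For the correction [g = - q Y *: Y], the first term is [|g|^2] and the second bounds the cross
    term [2 g.(gb Y - Y)] through [gen_bayes_inner]. *)
Let U Y : R := frob2 Y * q Y ^+ 2 + 2 * (k * q Y).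

Let mgb a i : mmeas (fun Y => gb Y a i).
Proof. exact: mmeas_gen_bayes. Qed.

Let mest a i : mmeas (fun Y => est Y a i).
Proof.
rewrite (_ : (fun Y => _) = fun Y => gb Y a i - q Y * Y a i).
  by apply: mmeasB; [exact: mgb|apply: mmeasM; [exact: mq|exact: mmeas_entry]].
by apply/funext => Y; rewrite /est [LHS]mxE; congr (_ + _); rewrite [LHS]mxE [X in - X]mxE.
Qed.

Let mloss (d : 'M[R]_(n, p) -> 'M[R]_(n, p)) M : (forall a i, mmeas (fun Y => d Y a i)) ->
  mmeas (fun Y => frob2 (d Y - M) * gdens Y M).
Proof.
move=> md; apply: mmeasM.
  rewrite /frob2; apply: mmeas_sum => a; apply: mmeas_sum => i; apply: mmeasX.
  rewrite (_ : (fun Y => _) = fun Y => d Y a i - M a i).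
    by apply: mmeasB; [exact: md|exact: mmeas_cst].
  by apply/funext => Y; rewrite [LHS]mxE; congr (_ + _); rewrite [LHS]mxE.
by under eq_fun do rewrite gdensC; exact: mmeas_gdens.
Qed.

(** The risk to be beaten must be finite for a strict comparison. By [gen_bayes_dist] the estimator
    stays at bounded distance from [Y] almost everywhere, so its loss is at most
    [2 n p + 2 |Y - M|^2]. *)
Let iloss M : mintegrable (fun Y => frob2 (gb Y - M) * gdens Y M).
Proof.
have ifr : mintegrable (fun Y => frob2 (Y - M) * gdens M Y).
  apply: (@mintegrable_gdens _ _ _ _ _ 8); first exact: mmeas_frob2.
  move=> Y; rewrite ger0_norm ?frob2_ge0//.
  have := expR_ge1Dx (frob2 (Y - M) / 4); have := frob2_ge0 (Y - M); lra.
have i1 : mintegrable (fun Y => gdens M Y).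
  rewrite (_ : (fun Y => _) = fun Y => 1 * gdens M Y); last first.
    by apply/funext => Y; rewrite mul1r.
  by apply: (@mintegrable_bounded_gdens _ _ _ _ _ 1) => [|Y]; [exact: mmeas_cst|rewrite normr1].
apply: (@ae_le_mintegrable _ (fun Y => 2 * (n * p)%:R * gdens M Y + 2 * (frob2 (Y - M) * gdens M Y))).
- exact: mloss mgb.
- by move=> Y; exact: mulr_ge0 (frob2_ge0 _) (gdens_ge0 _ _).
- move=> Y; apply: addr_ge0; apply: mulr_ge0 => //; first exact: gdens_ge0.
  exact: mulr_ge0 (frob2_ge0 _) (gdens_ge0 _ _).
- by apply: mintegrableD; exact: mintegrableZ.
apply: filterS (ae_svs_full_rank hnp) => t d0; rewrite gdensC mulrA -mulrDl.
apply: ler_wpM2r (gdens_ge0 _ _) _ _ _.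
have h := gen_bayes_dist hnp d0; rewrite -/gb in h.
have h2 := frob2_add_ge (gb (tmx t) - M) (M - tmx t); rewrite addrA subrK in h2.
have h3 : frob2 (M - tmx t) = frob2 (tmx t - M) by rewrite -frob2N opprB.
lra.
Qed.

Let frob2_sub (A B : 'M[R]_(n, p)) : frob2 (A - B) = frob2 A - 2 * inner B A + frob2 B.
Proof.
rewrite /frob2 /inner big_distrr/= -sumrB -big_split/=; apply: eq_bigr => a _.
rewrite big_distrr/= -sumrB -big_split/=; apply: eq_bigr => i _.
by rewrite [(A - B) a i]mxE [(- B) a i]mxE; ring.
Qed.

Let innerD (A B C : 'M[R]_(n, p)) : inner A (B + C) = inner A B + inner A C.
Proof.
rewrite /inner -big_split/=; apply: eq_bigr => a _; rewrite -big_split/=.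
by apply: eq_bigr => i _; rewrite mxE mulrDr.
Qed.

Let innerZl (x : R) (A B : 'M[R]_(n, p)) : inner (x *: A) B = x * inner A B.
Proof.
rewrite /inner big_distrr/=; apply: eq_bigr => a _; rewrite big_distrr/=.
by apply: eq_bigr => i _; rewrite mxE mulrA.
Qed.

(** Splitting [gb Y - M] at [Y] confines the unknown [M] to the term [inner Y (Y - M)], the only one
    left to Stein's identity. *)
Let loss_est Y M : 0 < \det (Y^T *m Y) ->
  frob2 (est Y - M) <= frob2 (gb Y - M) + U Y - 2 * (q Y * inner Y (Y - M)).
Proof.
move=> d0; have -> : est Y - M = (gb Y - M) - q Y *: Y by rewrite /est addrAC.
rewrite (frob2_sub (gb Y - M) (q Y *: Y)) innerZl frob2_scale.
have -> : gb Y - M = (gb Y - Y) + (Y - M) by rewrite addrA subrK.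
rewrite innerD mulrDr; have h := gen_bayes_inner hnp d0; rewrite -/gb -/k in h.
have := ler_wpM2l (ltW (q0 Y)) h; rewrite /U; nra.
Qed.

(** The pointwise excess [B] changes sign. Only its integral is negative, after Stein's identity has
    replaced [V] by the divergence, which makes the integrand negative everywhere. *)
Lemma svs_risk_lt M :
  mintegrable (fun Y => frob2 (est Y - M) * gdens Y M) /\
  mint (fun Y => frob2 (est Y - M) * gdens Y M) < mint (fun Y => frob2 (gb Y - M) * gdens Y M).
Proof.
pose V Y := \sum_a \sum_i (Y - M) a i * (Y a i * q Y) * gdens M Y.
have iVt a i : mintegrable (fun Y => (Y - M) a i * (Y a i * q Y) * gdens M Y).
  by have [] := stein_q M a i.
have iD a i : mintegrable (fun Y => dq Y a i * gdens M Y) by have [] := stein_q M a i.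
have [iV EV] := mint_sum2 iVt; have [iDs ED] := mint_sum2 iD.
have VE Y : V Y = q Y * inner Y (Y - M) * gdens M Y.
  rewrite /V /inner big_distrr/= mulr_suml; apply: eq_bigr => a _.
  by rewrite big_distrr/= mulr_suml; apply: eq_bigr => i _; ring.
have iU : mintegrable (fun Y => U Y * gdens M Y).
  apply: (@mintegrable_bounded_gdens _ _ _ _ _ (1 + 2 * `|k|)).
    apply: mmeasD; apply: mmeasM.
    - by have := @mmeas_frob2 R n p 0; rewrite /mmeas; under eq_fun do rewrite subr0.
    - by apply: mmeasX; exact: mq.
    - exact: mmeas_cst.
    - by apply: mmeasM; [exact: mmeas_cst|exact: mq].
  move=> Y; rewrite /U (le_trans (ler_normD _ _))//; apply: lerD.
    rewrite expr2 mulrA fq ger0_norm ?mulr_ge0 ?(ltW (q0 _)) ?subr_ge0 ?q1//.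
    have := q0 Y; have := q1 Y; nra.
  rewrite !normrM normr_nat ler_pM2l// (ger0_norm (ltW (q0 _))).
  by rewrite ler_piMr.
have iA := iloss M.
pose B Y := U Y * gdens M Y + (- 2) * V Y.
have iB : mintegrable B by apply: mintegrableD iU (mintegrableZ _ iV).
have B0 : mint B < 0.
  have EB : mint B = mint (fun Y => U Y * gdens M Y + (- 2) * \sum_a \sum_i dq Y a i * gdens M Y).
    rewrite /B mintD//; last exact: mintegrableZ.
    rewrite [RHS]mintD//; last exact: mintegrableZ.
    congr (_ + _); rewrite mintZ// mintZ//; congr (_ * _); rewrite EV ED.
    by apply: eq_bigr => a _; apply: eq_bigr => i _; have [_ _ ->] := stein_q M a i.
  rewrite EB -oppr_gt0 -[X in _ < X]mulN1r -mintZ; last by apply: mintegrableD iU (mintegrableZ _ iDs).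
  have pos Y : 0 < -1 * (U Y * gdens M Y + - 2 * \sum_a \sum_i dq Y a i * gdens M Y).
    have -> : \sum_a \sum_i dq Y a i * gdens M Y = (\sum_a \sum_i dq Y a i) * gdens M Y.
      by rewrite mulr_suml; apply: eq_bigr => a _; rewrite mulr_suml.
    rewrite sum_dq.
    (* Here [n p - k = p (p + 1)]. As [p] is at least 2, [2 p (p + 1)] is at least 12 and exceeds
       [5 |Y|^2 q], which equals [5 (1 - q)] by [fq]. *)
    have -> : -1 * (U Y * gdens M Y +
        - 2 * (((n * p)%:R * q Y - 2 * (frob2 Y * q Y ^+ 2)) * gdens M Y)) =
        q Y * (2 * (p%:R * (p%:R + 1)) - 5 * (frob2 Y * q Y)) * gdens M Y.
      by rewrite /U /k natrM; ring.
    rewrite fq; apply: mulr_gt0 (gdens_gt0 _ _); apply: mulr_gt0 (q0 Y) _.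
    have p2 : 2 <= p%:R :> R by rewrite ler_nat.
    have := q0 Y; nra.
  apply: mint_gt0.
  - by apply: mintegrableZ; apply: mintegrableD iU (mintegrableZ _ iDs).
  - by move=> Y; exact: ltW.
  - by apply: aeW => t.
have aAB : {ae lam, forall t, frob2 (est (tmx t) - M) * gdens (tmx t) M <=
    frob2 (gb (tmx t) - M) * gdens (tmx t) M + B (tmx t)}.
  apply: filterS (ae_svs_full_rank hnp) => t d0.
  rewrite /B VE (gdensC M (tmx t)).
  have -> : frob2 (gb (tmx t) - M) * gdens (tmx t) M + (U (tmx t) * gdens (tmx t) M +
      - 2 * (q (tmx t) * inner (tmx t) (tmx t - M) * gdens (tmx t) M)) =
      (frob2 (gb (tmx t) - M) + U (tmx t) - 2 * (q (tmx t) * inner (tmx t) (tmx t - M))) *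
        gdens (tmx t) M by ring.
  by apply: ler_wpM2r (gdens_ge0 _ _) _ _ _; exact: loss_est.
have iAB : mintegrable (fun Y => frob2 (gb Y - M) * gdens Y M + B Y) by exact: mintegrableD.
have iE : mintegrable (fun Y => frob2 (est Y - M) * gdens Y M).
  apply: (@ae_le_mintegrable _ (fun Y => `|frob2 (gb Y - M) * gdens Y M + B Y|)).
  - exact: mloss mest.
  - by move=> Y; exact: mulr_ge0 (frob2_ge0 _) (gdens_ge0 _ _).
  - by move=> Y.
  - exact: (integrable_norm iAB).
  - by apply: filterS aAB => t h; rewrite (le_trans h)// ler_norm.
split=> //; apply: (@le_lt_trans _ _ (mint (fun Y => frob2 (gb Y - M) * gdens Y M + B Y))).
  rewrite -subr_ge0 -[X in _ - X]mul1r -mulNr -mintZ// -mintD//; last exact: mintegrableZ.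
  apply: ae_mint_ge0; first by apply: mintegrableD => //; exact: mintegrableZ.
  by apply: filterS aAB => t h; rewrite mulN1r subr_ge0.
by rewrite mintD// gtrDl.
Qed.

Lemma frob_risk_mint (d : 'M[R]_(n, p) -> 'M[R]_(n, p)) M :
  mintegrable (fun Y => frob2 (d Y - M) * gdens Y M) ->
  frob_risk d M = (mint (fun Y => frob2 (d Y - M) * gdens Y M))%:E.
Proof. by move=> h; rewrite /frob_risk lebTE -mint_EFin. Qed.

Lemma svs_inadmissible : frob_inadmissible (gen_bayes (@pi_svs R n p)).
Proof.
have H M : (frob_risk est M < frob_risk gb M)%E.
  by have [iE h] := svs_risk_lt M; rewrite !frob_risk_mint// lte_fin.
exists est; split; first by move=> a i; exact: mest.
by split=> [M|]; [exact: ltW|exists 0].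
Qed.

End RiskComparison.

Theorem theorem1 (R : realType) (n p : nat) (hnp : (p.+1 < n)%N) (hp : (2 <= p)%N) :
  frob_inadmissible (gen_bayes (@pi_svs R n p)).
Proof. exact: svs_inadmissible. Qed.
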